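(* Under the standing assumptions (A1)–(A3) below, there exists $c>0$ such that the iterates $X^k$ of the 3-splitting proximal point ADMM satisfy, for all $k\ge1$, $$\frac1k\sum_{l=1}^k\|\nabla\mathcal{L}_\beta^{3s}(X^l)\|_F\le\frac{c}{\sqrt k}\qquad\text{and}\qquad\min_{1\le l\le k}\|\nabla\mathcal{L}_\beta^{3s}(X^l)\|_F\le\frac{c}{\sqrt k}.$$
   Context: Data $X\in\mathbb{R}^{d\times n}$, $Y\in\mathbb{R}^{q\times n}$, $N\ge3$, $\lambda,\mu>0$, $\beta_1,\dots,\beta_N>0$. Activations $\sigma_i$ ($i\le N-1$) real analytic with $|\sigma_i|\le\psi_0,|\sigma_i'|\le\psi_1,|\sigma_i''|\le\psi_2$ on $\mathbb{R}$ ($\psi_j>0$), applied entrywise. $\|\cdot\|_F$ Frobenius norm, $\langle A,B\rangle=\mathrm{tr}(AB^T)$, $V_0:=X$. Variables $W_i\in\mathbb{R}^{d\times d}$, $U_i,V_i,\Lambda_i\in\mathbb{R}^{d\times n}$ ($i\le N-1$), $W_N\in\mathbb{R}^{q\times d}$, $V_N,\Lambda_N\in\mathbb{R}^{q\times n}$; $\nabla$ is the gradient with respect to all these blocks. $\mathcal{L}_\beta^{3s}=\tfrac12\|V_N-Y\|_F^2+\tfrac\lambda2\sum_{i=1}^N\|W_i\|_F^2+\tfrac\mu2\sum_{i=1}^{N-1}\|V_{i-1}+\sigma_i(U_i)-V_i\|_F^2+\sum_{i=1}^{N-1}(\langle\Lambda_i,W_iV_{i-1}-U_i\rangle+\tfrac{\beta_i}2\|W_iV_{i-1}-U_i\|_F^2)+\langle\Lambda_N,W_NV_{N-1}-V_N\rangle+\tfrac{\beta_N}2\|W_NV_{N-1}-V_N\|_F^2$.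 3-splitting proximal point ADMM: arbitrary $W_i^0$; $U_i^0=W_i^0V_{i-1}^0$, $V_i^0=V_{i-1}^0+\sigma_i(U_i^0)$ ($i\le N-1$), $V_N^0=W_N^0V_{N-1}^0$, $\Lambda_i^0=O$; positive parameters $\omega_i^k$. For $k\ge1$: (a) $W_i^k=\arg\min_{W_i}\{\tfrac\lambda2\|W_i\|_F^2+\tfrac{\beta_i}2\|W_iV_{i-1}^{k-1}-U_i^{k-1}+\Lambda_i^{k-1}/\beta_i\|_F^2\}$ ($i\le N-1$) and $W_N^k=\arg\min\{\tfrac\lambda2\|W_N\|_F^2+\tfrac{\beta_N}2\|W_NV_{N-1}^{k-1}-V_N^{k-1}+\Lambda_N^{k-1}/\beta_N\|_F^2\}$; (b) for $i=1,\dots,N-1$ in order: $U_i^k$ is a (fixed) minimizer of $\tfrac\mu2\|V_{i-1}^k+\sigma_i(U_i)-V_i^{k-1}\|_F^2+\tfrac{\beta_i}2\|U_i-W_i^kV_{i-1}^k-\Lambda_i^{k-1}/\beta_i\|_F^2+\tfrac{\omega_i^{k-1}}2\|U_i-U_i^{k-1}\|_F^2$; then, if $i\le N-2$, $V_i^k=\arg\min_{V_i}\{\tfrac\mu2\|V_{i-1}^k+\sigma_i(U_i^k)-V_i\|_F^2+\tfrac\mu2\|V_i+\sigma_{i+1}(U_{i+1}^{k-1})-V_{i+1}^{k-1}\|_F^2+\tfrac{\beta_{i+1}}2\|W_{i+1}^kV_i-U_{i+1}^{k-1}+\Lambda_{i+1}^{k-1}/\beta_{i+1}\|_F^2\}$,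 and if $i=N-1$, $V_{N-1}^k=\arg\min\{\tfrac\mu2\|V_{N-1}-V_{N-2}^k-\sigma_{N-1}(U_{N-1}^k)\|_F^2+\tfrac{\beta_N}2\|W_N^kV_{N-1}-V_N^{k-1}+\Lambda_N^{k-1}/\beta_N\|_F^2\}$; (c) $V_N^k=\frac1{1+\beta_N}(Y+\beta_NW_N^kV_{N-1}^k+\Lambda_N^{k-1})$; (d) $\Lambda_i^k=\Lambda_i^{k-1}+\beta_i(W_i^kV_{i-1}^k-U_i^k)$ ($i\le N-1$), $\Lambda_N^k=\Lambda_N^{k-1}+\beta_N(W_N^kV_{N-1}^k-V_N^k)$. $X^k$ collects all blocks at iteration $k$. Assumptions: fix $\mathcal{V}_0^{\max}>\|X\|_F$ and $\mathcal{V}_1^{\max},\dots,\mathcal{V}_{N-1}^{\max}>0$; let $a_i:=\psi_0\psi_2+\psi_1^2+\mathcal{V}_i^{\max}\psi_2+\mathcal{V}_{i-1}^{\max}\psi_2$. (A1) $\beta_i>\max\{32(1+\sqrt2)\mu a_i,\,16\mu\psi_1^2\}$ for $i\le N-1$, and $\beta_N>1$. (A2) With $\Delta_i:=(\beta_i/4-8\mu a_i)^2-128\mu^2a_i^2$, $\hat\epsilon_i\in(0,\sqrt{\Delta_i}/32)$, $\omega_i^{\min}:=\frac{\beta_i/4-8\mu a_i-\sqrt{\Delta_i}}{16}+\hat\epsilon_i$, $\epsilon_i\in(0,\omega_i^{\min}/4)$, $\omega_i^{\max}:=\min\{\frac{\beta_i/4-8\mu a_i+\sqrt{\Delta_i}}{16}-\hat\epsilon_i,\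 \sqrt{(\omega_i^{\min})^2+\beta_i\omega_i^{\min}/16-\beta_i\epsilon_i/4}\}$, the parameters satisfy $\omega_i^{\min}<\omega_i^k\le\omega_i^{k+1}<\omega_i^{\max}$ for all $k\ge0$, $i\le N-1$. (A3) The generated iterates satisfy $\|V_i^k\|_F\le\mathcal{V}_i^{\max}$ for all $i\le N-1$, $k\ge0$. *)

(* Defs.v *)
From HB Require Import structures.
From mathcomp Require Import all_boot all_order all_algebra.
From mathcomp Require Import all_classical all_reals all_analysis.
Set Implicit Arguments. Unset Strict Implicit. Unset Printing Implicit Defensive.
Import Order.TTheory GRing.Theory Num.Theory.
Import numFieldNormedType.Exports.
Local Open Scope classical_set_scope.
Local Open Scope ring_scope.

Section Defs.
Variable R : realType.

Definition frob_inner m n (A B : 'M[R]_(m, n)) : R := \tr (A *m B^T).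
Definition frob m n (A : 'M[R]_(m, n)) : R := Num.sqrt (frob_inner A A).

Definition real_analytic (f : R -> R) : Prop :=
  forall x0 : R, exists r : R, 0 < r /\ exists a : nat -> R,
    forall x : R, `|x - x0| < r ->
      (fun N : nat => \sum_(k < N) a k * (x - x0) ^+ k) @ \oo --> f x.

Definition act m n (s : R -> R) (A : 'M[R]_(m, n)) : 'M[R]_(m, n) := map_mx s A.

Variables (d n q : nat).

(* All blocks of the variable X. Families indexed by nat: only indices
   i = 1 .. N-1 are meaningful for W, U, V, Lam; V_0 is the data X. *)
Record state := State {
  sW : nat -> 'M[R]_(d, d);
  sWN : 'M[R]_(q, d);
  sU : nat -> 'M[R]_(d, n);
  sV : nat -> 'M[R]_(d, n);
  sVN : 'M[R]_(q, n);
  sLam : nat -> 'M[R]_(d, n);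
  sLamN : 'M[R]_(q, n) }.

Variables (N : nat) (X : 'M[R]_(d, n)) (Y : 'M[R]_(q, n))
  (lam mu : R) (beta : nat -> R) (sigma : nat -> R -> R).

Definition Vx (V : nat -> 'M[R]_(d, n)) (i : nat) : 'M[R]_(d, n) :=
  if i is 0 then X else V i.

Definition Lag (s : state) : R :=
  let V := Vx (sV s) in
  (1/2) * frob_inner (sVN s - Y) (sVN s - Y)
  + (lam / 2) * (\sum_(1 <= i < N) frob_inner (sW s i) (sW s i)
                 + frob_inner (sWN s) (sWN s))
  + (mu / 2) * \sum_(1 <= i < N)
       frob_inner (V i.-1 + act (sigma i) (sU s i) - V i)
                  (V i.-1 + act (sigma i) (sU s i) - V i)
  + \sum_(1 <= i < N)
      (frob_inner (sLam s i) (sW s i *m V i.-1 - sU s i)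
       + (beta i / 2) * frob_inner (sW s i *m V i.-1 - sU s i)
                                   (sW s i *m V i.-1 - sU s i))
  + frob_inner (sLamN s) (sWN s *m V N.-1 - sVN s)
  + (beta N / 2) * frob_inner (sWN s *m V N.-1 - sVN s)
                              (sWN s *m V N.-1 - sVN s).

Definition upd (T : Type) (f : nat -> T) (i : nat) (x : T) : nat -> T :=
  fun j => if j == i then x else f j.

Definition dW (s : state) i (a b : 'I_d) : R :=
  derive1 (fun t : R => Lag (State (upd (sW s) i (sW s i + t *: delta_mx a b))
     (sWN s) (sU s) (sV s) (sVN s) (sLam s) (sLamN s))) 0.
Definition dWN (s : state) (a : 'I_q) (b : 'I_d) : R :=
  derive1 (fun t : R => Lag (State (sW s) (sWN s + t *: delta_mx a b)
     (sU s) (sV s) (sVN s) (sLam s) (sLamN s))) 0.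
Definition dU (s : state) i (a : 'I_d) (b : 'I_n) : R :=
  derive1 (fun t : R => Lag (State (sW s) (sWN s)
     (upd (sU s) i (sU s i + t *: delta_mx a b)) (sV s) (sVN s) (sLam s) (sLamN s))) 0.
Definition dV (s : state) i (a : 'I_d) (b : 'I_n) : R :=
  derive1 (fun t : R => Lag (State (sW s) (sWN s) (sU s)
     (upd (sV s) i (sV s i + t *: delta_mx a b)) (sVN s) (sLam s) (sLamN s))) 0.
Definition dVN (s : state) (a : 'I_q) (b : 'I_n) : R :=
  derive1 (fun t : R => Lag (State (sW s) (sWN s) (sU s) (sV s)
     (sVN s + t *: delta_mx a b) (sLam s) (sLamN s))) 0.
Definition dLam (s : state) i (a : 'I_d) (b : 'I_n) : R :=
  derive1 (fun t : R => Lag (State (sW s) (sWN s) (sU s) (sV s) (sVN s)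
     (upd (sLam s) i (sLam s i + t *: delta_mx a b)) (sLamN s))) 0.
Definition dLamN (s : state) (a : 'I_q) (b : 'I_n) : R :=
  derive1 (fun t : R => Lag (State (sW s) (sWN s) (sU s) (sV s) (sVN s)
     (sLam s) (sLamN s + t *: delta_mx a b))) 0.

Definition grad_norm (s : state) : R :=
  Num.sqrt (
    \sum_(1 <= i < N) (\sum_a \sum_b (dW s i a b) ^+ 2
                       + \sum_a \sum_b (dU s i a b) ^+ 2
                       + \sum_a \sum_b (dV s i a b) ^+ 2
                       + \sum_a \sum_b (dLam s i a b) ^+ 2)
    + \sum_a \sum_b (dWN s a b) ^+ 2
    + \sum_a \sum_b (dVN s a b) ^+ 2
    + \sum_a \sum_b (dLamN s a b) ^+ 2).

Definition is_3s_ppADMM (omega : nat -> nat -> R) (Xs : nat -> state) : Prop :=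
  let W k := sW (Xs k) in let WN k := sWN (Xs k) in
  let U k := sU (Xs k) in let V k := Vx (sV (Xs k)) in
  let VN k := sVN (Xs k) in let Lm k := sLam (Xs k) in
  let LmN k := sLamN (Xs k) in
  (forall i, (1 <= i < N)%N ->
      U 0%N i = W 0%N i *m V 0%N i.-1 /\
      V 0%N i = V 0%N i.-1 + act (sigma i) (U 0%N i) /\
      Lm 0%N i = 0)
  /\ VN 0%N = WN 0%N *m V 0%N N.-1 /\ LmN 0%N = 0
  /\ forall k, (1 <= k)%N ->
  (forall i, (1 <= i < N)%N -> forall W' : 'M[R]_(d, d),
      (lam / 2) * frob_inner (W k i) (W k i)
      + (beta i / 2) * frob_inner
           (W k i *m V k.-1 i.-1 - U k.-1 i + (beta i)^-1 *: Lm k.-1 i)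
           (W k i *m V k.-1 i.-1 - U k.-1 i + (beta i)^-1 *: Lm k.-1 i)
      <= (lam / 2) * frob_inner W' W'
      + (beta i / 2) * frob_inner
           (W' *m V k.-1 i.-1 - U k.-1 i + (beta i)^-1 *: Lm k.-1 i)
           (W' *m V k.-1 i.-1 - U k.-1 i + (beta i)^-1 *: Lm k.-1 i))
  /\ (forall W' : 'M[R]_(q, d),
      (lam / 2) * frob_inner (WN k) (WN k)
      + (beta N / 2) * frob_inner
           (WN k *m V k.-1 N.-1 - VN k.-1 + (beta N)^-1 *: LmN k.-1)
           (WN k *m V k.-1 N.-1 - VN k.-1 + (beta N)^-1 *: LmN k.-1)
      <= (lam / 2) * frob_inner W' W'
      + (beta N / 2) * frob_inner
           (W' *m V k.-1 N.-1 - VN k.-1 + (beta N)^-1 *: LmN k.-1)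
           (W' *m V k.-1 N.-1 - VN k.-1 + (beta N)^-1 *: LmN k.-1))
  /\ (forall i, (1 <= i < N)%N -> forall U' : 'M[R]_(d, n),
      let g (Z : 'M[R]_(d, n)) :=
        (mu / 2) * frob_inner (V k i.-1 + act (sigma i) Z - V k.-1 i)
                              (V k i.-1 + act (sigma i) Z - V k.-1 i)
        + (beta i / 2) * frob_inner
             (Z - W k i *m V k i.-1 - (beta i)^-1 *: Lm k.-1 i)
             (Z - W k i *m V k i.-1 - (beta i)^-1 *: Lm k.-1 i)
        + (omega i k.-1 / 2) * frob_inner (Z - U k.-1 i) (Z - U k.-1 i) in
      g (U k i) <= g U')
  /\ (forall i, (1 <= i)%N -> (i <= N - 2)%N -> forall V' : 'M[R]_(d, n),
      let h (Z : 'M[R]_(d, n)) :=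
        (mu / 2) * frob_inner (V k i.-1 + act (sigma i) (U k i) - Z)
                              (V k i.-1 + act (sigma i) (U k i) - Z)
        + (mu / 2) * frob_inner (Z + act (sigma i.+1) (U k.-1 i.+1) - V k.-1 i.+1)
                                (Z + act (sigma i.+1) (U k.-1 i.+1) - V k.-1 i.+1)
        + (beta i.+1 / 2) * frob_inner
             (W k i.+1 *m Z - U k.-1 i.+1 + (beta i.+1)^-1 *: Lm k.-1 i.+1)
             (W k i.+1 *m Z - U k.-1 i.+1 + (beta i.+1)^-1 *: Lm k.-1 i.+1) in
      h (V k i) <= h V')
  /\ (forall V' : 'M[R]_(d, n),
      let h (Z : 'M[R]_(d, n)) :=
        (mu / 2) * frob_inner (Z - V k N.-2 - act (sigma N.-1) (U k N.-1))
                              (Z - V k N.-2 - act (sigma N.-1) (U k N.-1))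
        + (beta N / 2) * frob_inner
             (WN k *m Z - VN k.-1 + (beta N)^-1 *: LmN k.-1)
             (WN k *m Z - VN k.-1 + (beta N)^-1 *: LmN k.-1) in
      h (V k N.-1) <= h V')
  /\ VN k = (1 + beta N)^-1 *: (Y + beta N *: (WN k *m V k N.-1) + LmN k.-1)
  /\ (forall i, (1 <= i < N)%N ->
        Lm k i = Lm k.-1 i + beta i *: (W k i *m V k i.-1 - U k i))
  /\ LmN k = LmN k.-1 + beta N *: (WN k *m V k N.-1 - VN k).

End Defs.

(* Main.v *)
(* Write [dZ^k = Z^k - Z^(k-1)]. Every primal update exactly minimises the
   Lagrangian in its block (plus the proximal term for [U_i]), so one sweep
   lowers it by a multiple of [|dZ|^2] in every primal block, while the
   multiplier update raises it by [sum_i |dLam_i|^2 / beta_i]. Stationarity of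
   the [U_i]-step gives
     [Lam_i^k = mu (V_(i-1)^k + sigma_i(U_i^k) - V_i^(k-1)) o sigma_i'(U_i^k)
                + omega_i^(k-1) dU_i^k],
   so [dLam_i^k] is controlled by [dU_i] and [dV] at the two last iterations;
   similarly [Lam_N^k = V_N^k - Y]. Adding
     [4 (omega_i^(k-1))^2 / beta_i |dU_i^k|^2 + 4 mu^2 psi1^2 / beta_i |dV_i^k|^2]
   to the Lagrangian produces, under (A1) and (A2), a potential that decreases
   by a multiple of the squared increments and is bounded below. Hence the
   iterates are bounded and the squared increments are summable. The gradient at
   [X^k] is a combination, with bounded coefficients, of the increments at [k]
   and [k-1], so its squared norm is summable too, and Cauchy-Schwarz concludes. *)

Require Import Defs.
From HB Require Import structures.
From mathcomp Require Import all_boot all_order all_algebra.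
From mathcomp Require Import all_classical all_reals all_analysis.
From mathcomp Require Import ring lra.
Import Order.TTheory GRing.Theory Num.Theory.
Import numFieldNormedType.Exports.
Local Open Scope ring_scope.
Set Implicit Arguments.
Unset Strict Implicit.
Unset Printing Implicit Defensive.

(** * Real-analytic functions *)

(** The multiplier increment at one iteration involves primal increments of the previous one, so the
    Lagrangian alone need not decrease; the potential stores what the next multiplier step will
    cost. Cutting the increment of [Lam_i] into four pieces produces the factor 4. An increment of
    [U_i] then costs [4 (mu a_i + omega)^2 / beta_i] now and [4 omega^2 / beta_i] at the next sweep,
    against the gain [omega / 2] of the proximal term. Requiring a total cost of at most [omega / 4]
    is the inequality [8 omega^2 + 8 mu a_i omega + 4 mu^2 a_i^2 <= beta_i omega / 4]; its roots in
    [omega] are the expressions with [sqrt Delta_i] in (A2). Likewise [16 mu psi1^2 < beta_i] makes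
    [4 mu^2 psi1^2 / beta_i] at most [mu / 4]; an increment of [V_i] is charged this way by layers
    [i] and [i+1]. The condition [beta_N > 1] gives both [(1 + beta_N) / 2 > 1 / beta_N], for the
    descent in [V_N], and [1 / beta_N < 1], for the lower bound. Boundedness is proved for [W],
    [Lam] and [V_N], while [U_i] itself is never bounded: [Lam_i + beta_i (W_i V_(i-1) - U_i)]
    equals [Lam_i] plus its last increment. *)

Lemma mulnX_le (R : realFieldType) (z r : R) (n : nat) :
  0 <= z -> z <= r -> n.+1%:R * z ^+ n * (r - z) <= r ^+ n.+1.
Proof.
move=> z0 zr; elim: n => [|n IH]; first by rewrite expr0 expr1; lra.
have h1 : z * (n.+1%:R * z ^+ n * (r - z)) <= z * r ^+ n.+1 by apply: ler_wpM2l.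
have h2 : z ^+ n.+1 * (r - z) <= r ^+ n.+1 * (r - z).
  by apply: ler_wpM2r; [lra | apply: lerXn2r => //; rewrite nnegrE; lra].
have -> : n.+2%:R * z ^+ n.+1 * (r - z) =
   z * (n.+1%:R * z ^+ n * (r - z)) + z ^+ n.+1 * (r - z).
  by rewrite (_ : n.+2%:R = n.+1%:R + 1 :> R) 1?exprS; [ring | rewrite -natr1].
have -> : r ^+ n.+2 = z * r ^+ n.+1 + r ^+ n.+1 * (r - z) by rewrite [LHS]exprS; ring.
exact: lerD.
Qed.

(** Convergence at [x] bounds [f n * x ^ n]. For [r] strictly between [|z|] and [|x|], [mulnX_le]
    absorbs the factor [n + 1] of the differentiated term into [r ^ n.+1 / (r - |z|)], and the ratio
    [r / |x| < 1] gives a geometric majorant. *)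
Lemma is_cvg_pseries_diffs (R : realType) (f : nat -> R) (x z : R) :
  cvgn (pseries f x) -> `|z| < `|x| -> cvgn (pseries (pseries_diffs f) z).
Proof.
move=> Cx zx; have [K [Kreal Kf]] := cvg_series_bounded Cx.
have fK n : `|f n| * `|x| ^+ n <= `|K + 1|.
  rewrite -normrX -normrM; apply: (Kf (`|K + 1|)) => //.
  by apply: (lt_le_trans _ (ler_norm _)); rewrite ltrDl.
have x0 : 0 < `|x| by apply: le_lt_trans zx.
have z0 : 0 <= `|z| by [].
pose r := (`|z| + `|x|) / 2.
have zr : `|z| < r by rewrite /r; lra.
have rx : r < `|x| by rewrite /r; lra.
have r0 : 0 <= r by lra.
have rx1 : r / `|x| < 1 by rewrite ltr_pdivrMr // mul1r.
apply: normed_cvg.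
apply: (@series_le_cvg _ _
  (geometric (`|K + 1| * (r / `|x|) / (r - `|z|)) (r / `|x|))) => [//=|n|n|].
- have c0 : 0 <= r / `|x| by rewrite divr_ge0.
  rewrite /geometric /=; apply: mulr_ge0; last exact: exprn_ge0.
  by apply: divr_ge0; [exact: mulr_ge0 | rewrite subr_ge0 ltW].
- rewrite /= /pseries_diffs !normrM normrX normr_nat.
  have -> : n.+1%:R * `|f n.+1| * `|z| ^+ n =
     `|f n.+1| * (n.+1%:R * `|z| ^+ n * (r - `|z|)) / (r - `|z|).
    by field; rewrite gt_eqF // subr_gt0.
  have -> : `|K + 1| * (r / `|x|) / (r - `|z|) * (r / `|x|) ^+ n =
     `|K + 1| * (r / `|x|) ^+ n.+1 / (r - `|z|).
    by rewrite exprS; ring.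
  apply: ler_wpM2r; first by rewrite invr_ge0; lra.
  apply: (@le_trans _ _ (`|f n.+1| * r ^+ n.+1)).
    by apply: ler_wpM2l => //; apply: mulnX_le => //; lra.
  have -> : r ^+ n.+1 = `|x| ^+ n.+1 * (r / `|x|) ^+ n.+1.
    by rewrite -exprMn; congr (_ ^+ _); field; rewrite -normr_eq0 normr_id gt_eqF.
  rewrite mulrA; apply: ler_wpM2r => //.
  by rewrite exprn_ge0 // divr_ge0.
- by apply: is_cvg_geometric_series; rewrite ger0_norm // divr_ge0.
Qed.

Lemma pseriesE (R : realType) (f : nat -> R) (x : R) :
  pseries f x = (fun n => \sum_(k < n) f k * x ^+ k).
Proof. by apply/funext => n; rewrite /pseries /series /= big_mkord. Qed.

Lemma real_analytic_is_derive (R : realType) (f : R -> R) :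
  real_analytic f ->
  forall x0, exists r, 0 < r /\ exists a : nat -> R, forall x, `|x - x0| < r ->
    cvgn (pseries (pseries_diffs a) (x - x0)) /\
    is_derive x 1 f (limn (pseries (pseries_diffs a) (x - x0))).
Proof.
move=> fa x0; have [r [r0 [a ha]]] := fa x0.
exists r; split=> //; exists a => x xr.
have cvga y : `|y| < r -> (pseries a y @ \oo --> f (y + x0))%classic.
  move=> yr; have := ha (y + x0); rewrite addrK => /(_ yr).
  by rewrite pseriesE.
(* Each termwise differentiation costs some radius. The points [K (3/4)], [K (2/4)], [K (1/4)] lie
   between [|x - x0|] and [r] and carry the convergence of the series and of its first and second
   formal derivatives. *)
pose K i := (`|x - x0| + (r - `|x - x0|) * i).
have hK i : 0 <= i -> i < 1 -> 0 <= K i /\ `|K i| < r.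
  move=> i0 i1; have : 0 <= `|x - x0| by [].
  move=> h; have h2 : 0 <= (r - `|x - x0|) * i by apply: mulr_ge0 => //; lra.
  have h3 : 0 <= K i by rewrite /K; lra.
  split=> //; rewrite ger0_norm // /K.
  have : (r - `|x - x0|) * i < (r - `|x - x0|) * 1 by rewrite ltr_pM2l //; lra.
  by lra.
have Kmono i j : 0 <= i -> i < j -> j < 1 -> `|K i| < `|K j|.
  move=> i0 ij j1.
  rewrite !ger0_norm; [|by apply hK; lra|by apply hK; lra].
  by rewrite /K ltrD2l ltr_pM2l //; lra.
have c0 : cvgn (pseries a (K (3/4))) by apply/cvg_ex; eexists; apply: cvga; apply hK; lra.
have c1 : cvgn (pseries (pseries_diffs a) (K (2/4))).
  by apply: is_cvg_pseries_diffs c0 _; apply: Kmono; lra.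
have c2 : cvgn (pseries (pseries_diffs (pseries_diffs a)) (K (1/4))).
  by apply: is_cvg_pseries_diffs c1 _; apply: Kmono; lra.
have xK : `|x - x0| < `|K (1/4)|.
  rewrite [ltRHS]ger0_norm; last by apply hK; lra.
  by rewrite /K ltrDl mulr_gt0 //; lra.
split.
  apply: (is_cvg_pseries_inside c1); apply: (lt_trans xK); apply: Kmono; lra.
have D : is_derive (x - x0) 1 (fun y => limn (pseries a y))
   (limn (pseries (pseries_diffs a) (x - x0))).
  apply: (@pseries_snd_diffs _ _ (K (1/4))) => //.
  - by apply: (is_cvg_pseries_inside c0); apply: Kmono; lra.
  - by apply: (is_cvg_pseries_inside c1); apply: Kmono; lra.
have D' : is_derive x 1 ((fun y => limn (pseries a y)) \o (fun y => y - x0))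
   (limn (pseries (pseries_diffs a) (x - x0))).
  rewrite -[X in is_derive _ _ _ X]mulr1; apply: is_derive1_comp.
  rewrite -[X in is_derive _ _ _ X]addr0.
  have -> : (fun y : R => y - x0) = id + cst (- x0) by apply/funext.
  exact: is_deriveD.
apply: near_eq_is_derive D'.
have hb : nbhs x (ball x (r - `|x - x0|)) by apply: nbhsx_ballx; rewrite subr_gt0.
near=> y.
have yb : ball x (r - `|x - x0|) y by near: y.
have yr : `|y - x0| < r.
  move: yb; rewrite /ball /= => yb.
  have -> : y - x0 = (x - x0) - (x - y) by ring.
  by apply: (le_lt_trans (ler_normB _ _)); lra.
rewrite /=; have := cvga _ yr; rewrite subrK => h.
exact: cvg_lim.
Unshelve. all: by end_near.
Qed.

Lemma real_analytic_derivable (R : realType) (f : R -> R) (x : R) :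
  real_analytic f -> derivable f x 1.
Proof.
move=> /real_analytic_is_derive /(_ x) [r [r0 [a /(_ x)]]].
by rewrite subrr normr0 => /(_ r0) [_ []].
Qed.

(** This makes [derive1 (sigma i)] derivable in its turn, so the bound on the second derivative
    yields a Lipschitz constant for the first. *)
Lemma real_analytic_derive1 (R : realType) (f : R -> R) :
  real_analytic f -> real_analytic (derive1 f).
Proof.
move=> fa x0; have [r [r0 [a ha]]] := real_analytic_is_derive fa x0.
exists r; split=> //; exists (pseries_diffs a) => x /ha [cv [_ dv]].
have -> : derive1 f x = limn (pseries (pseries_diffs a) (x - x0)).
  by rewrite derive1E dv.
by move: cv; rewrite pseriesE.
Qed.

Lemma bounded_derive1_lipschitz (R : realType) (f : R -> R) (K : R) :
  (forall x, derivable f x 1) -> (forall x, `|derive1 f x| <= K) ->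
  forall x y, `|f x - f y| <= K * `|x - y|.
Proof.
move=> df fK x y; wlog : x y / y <= x => [H|yx].
  have [|/ltW] := leP y x; first exact: H.
  by rewrite distrC [X in K * X]distrC; exact: H.
have [||c _ ->] := @MVT_segment _ f (derive1 f) y x yx.
- by move=> z _; apply: DeriveDef => //; rewrite derive1E.
- by apply: derivable_within_continuous => z _; exact: df.
by rewrite normrM ler_wpM2r.
Qed.

Lemma is_derive_at_min (R : realType) (f : R -> R) (c df : R) :
  (forall t, derivable f t 1) -> is_derive c 1 f df ->
  (forall t, f c <= f t) -> df = 0.
Proof.
move=> fd [_ <-] cmin; have [] // : is_derive c 1 f 0.
apply: (@derive1_at_min _ f (c - 1) (c + 1)) => //; first by lra.
by rewrite in_itv /=; apply/andP; split; lra.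
Qed.

(** * Frobenius inner product *)

Notation sqn A := (frob_inner A A).

Section Frobenius.
Variable R : realType.
Implicit Types (m n p : nat) (k : R).

Lemma frob_innerE m n (A B : 'M[R]_(m, n)) :
  frob_inner A B = \sum_a \sum_b A a b * B a b.
Proof.
rewrite /frob_inner /mxtrace; apply: eq_bigr => a _.
by rewrite mxE; apply: eq_bigr => b _; rewrite mxE.
Qed.

Lemma frob_innerC m n (A B : 'M[R]_(m, n)) : frob_inner A B = frob_inner B A.
Proof.
by rewrite !frob_innerE; do 2 (apply: eq_bigr => ? _); rewrite mulrC.
Qed.

Lemma frob_innerDl m n (A B C : 'M[R]_(m, n)) :
  frob_inner (A + B) C = frob_inner A C + frob_inner B C.
Proof. by rewrite /frob_inner mulmxDl mxtraceD. Qed.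

Lemma frob_innerZl m n k (A C : 'M[R]_(m, n)) :
  frob_inner (k *: A) C = k * frob_inner A C.
Proof. by rewrite /frob_inner -scalemxAl mxtraceZ. Qed.

Lemma frob_innerNl m n (A C : 'M[R]_(m, n)) : frob_inner (- A) C = - frob_inner A C.
Proof. by rewrite -scaleN1r frob_innerZl mulN1r. Qed.

Lemma frob_innerDr m n (A B C : 'M[R]_(m, n)) :
  frob_inner C (A + B) = frob_inner C A + frob_inner C B.
Proof. by rewrite frob_innerC frob_innerDl !(frob_innerC C). Qed.

Lemma frob_innerZr m n k (A C : 'M[R]_(m, n)) :
  frob_inner C (k *: A) = k * frob_inner C A.
Proof. by rewrite frob_innerC frob_innerZl (frob_innerC C). Qed.

Lemma frob_innerNr m n (A C : 'M[R]_(m, n)) : frob_inner C (- A) = - frob_inner C A.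
Proof. by rewrite frob_innerC frob_innerNl (frob_innerC C). Qed.

Lemma frob_inner0l m n (C : 'M[R]_(m, n)) : frob_inner 0 C = 0.
Proof. by rewrite -(scale0r 0) frob_innerZl mul0r. Qed.

Lemma frob_inner0r m n (C : 'M[R]_(m, n)) : frob_inner C 0 = 0.
Proof. by rewrite frob_innerC frob_inner0l. Qed.

Definition frob_lin := (frob_innerDl, frob_innerDr, frob_innerZl, frob_innerZr,
  frob_innerNl, frob_innerNr).

Lemma frob_inner_mull m n p (A : 'M[R]_(m, n)) (B : 'M[R]_(n, p)) C :
  frob_inner (A *m B) C = frob_inner B (A^T *m C).
Proof.
by rewrite /frob_inner trmx_mul trmxK -mulmxA mxtrace_mulC -mulmxA.
Qed.

Lemma frob_inner_mulr m n p (A : 'M[R]_(m, n)) (B : 'M[R]_(n, p)) C :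
  frob_inner (A *m B) C = frob_inner A (C *m B^T).
Proof. by rewrite /frob_inner trmx_mul trmxK mulmxA. Qed.

Lemma sqnE m n (A : 'M[R]_(m, n)) : sqn A = \sum_a \sum_b A a b ^+ 2.
Proof. by rewrite frob_innerE; do 2 (apply: eq_bigr => ? _). Qed.

Lemma sqn_ge0 m n (A : 'M[R]_(m, n)) : 0 <= sqn A.
Proof. by rewrite sqnE; do 2 (apply: sumr_ge0 => ? _); rewrite sqr_ge0. Qed.

Lemma sqr_entry_le m n (A : 'M[R]_(m, n)) a b : A a b ^+ 2 <= sqn A.
Proof.
rewrite sqnE (bigD1 a) //= (bigD1 b) //= -addrA lerDl addr_ge0 //.
  by apply: sumr_ge0 => ? _; rewrite sqr_ge0.
by do 2 (apply: sumr_ge0 => ? _); rewrite sqr_ge0.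
Qed.

Lemma entry_le_frob m n (A : 'M[R]_(m, n)) a b : `|A a b| <= frob A.
Proof. by rewrite /frob -sqrtr_sqr ler_wsqrtr // sqr_entry_le. Qed.

Lemma sqn0_eq0 m n (A : 'M[R]_(m, n)) : sqn A = 0 -> A = 0.
Proof.
move=> A0; apply/matrixP => a b; rewrite mxE; apply/eqP.
by rewrite -sqrf_eq0 eq_le sqr_ge0 andbT -A0 sqr_entry_le.
Qed.

Lemma frob_inner_delta m n (A : 'M[R]_(m, n)) a b : frob_inner A (delta_mx a b) = A a b.
Proof.
rewrite frob_innerE (bigD1 a) //= (bigD1 b) //= !mxE !eqxx mulr1.
rewrite [X in _ + X + _]big1 => [|j jb]; last by rewrite mxE (negPf jb) andbF mulr0.
rewrite big1 ?addr0 // => i ia; apply: big1 => j _.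
by rewrite mxE (negPf ia) mulr0.
Qed.

Lemma sqnD m n (A B : 'M[R]_(m, n)) : sqn (A + B) = sqn A + 2 * frob_inner A B + sqn B.
Proof. by rewrite !frob_lin (frob_innerC B A); ring. Qed.

Lemma sqnN m n (A : 'M[R]_(m, n)) : sqn (- A) = sqn A.
Proof. by rewrite !frob_lin opprK. Qed.

Lemma sqnZ m n k (A : 'M[R]_(m, n)) : sqn (k *: A) = k ^+ 2 * sqn A.
Proof. by rewrite !frob_lin; ring. Qed.

Lemma sqnD_le m n (A B : 'M[R]_(m, n)) : sqn (A + B) <= 2 * (sqn A + sqn B).
Proof. by have := sqn_ge0 (A - B); rewrite !sqnD sqnN frob_innerNr; lra. Qed.

Lemma sqnD4_le m n (A B C D : 'M[R]_(m, n)) :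
  sqn (A + B + (C + D)) <= 4 * (sqn A + sqn B + sqn C + sqn D).
Proof.
by have := sqnD_le (A + B) (C + D); have := sqnD_le A B; have := sqnD_le C D; lra.
Qed.

Lemma sqn_le_entrywise m n (A B : 'M[R]_(m, n)) k :
  (forall a b, `|A a b| <= k * `|B a b|) -> sqn A <= k ^+ 2 * sqn B.
Proof.
move=> AB; rewrite !sqnE mulr_sumr; apply: ler_sum => a _.
rewrite mulr_sumr; apply: ler_sum => b _.
rewrite -real_normK ?num_real // -[B a b ^+ 2]real_normK ?num_real // -exprMn.
by apply: lerXn2r; rewrite ?nnegrE // (le_trans _ (AB a b)).
Qed.

(** Lagrange's identity: the double sum of the squares [(f i * g j - f j * g i) ^+ 2] is twice the
    gap between the two sides. *)
Lemma cauchy_schwarz_sum (I : finType) (f g : I -> R) :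
  (\sum_i f i * g i) ^+ 2 <= (\sum_i f i ^+ 2) * (\sum_i g i ^+ 2).
Proof.
have : 0 <= \sum_i \sum_j (f i * g j - f j * g i) ^+ 2.
  by do 2 (apply: sumr_ge0 => ? _); rewrite sqr_ge0.
have e i j : (f i * g j - f j * g i) ^+ 2 =
    f i ^+ 2 * g j ^+ 2 + g i ^+ 2 * f j ^+ 2 + -2 * (f i * g i) * (f j * g j) by ring.
under eq_bigr => i _.
  under eq_bigr => j _ do rewrite e.
  rewrite !big_split /= -!mulr_sumr.
  over.
by rewrite !big_split /= -!mulr_suml -mulr_sumr; nra.
Qed.

Lemma sqn_mulmx_le m n p (A : 'M[R]_(m, n)) (B : 'M[R]_(n, p)) :
  sqn (A *m B) <= sqn A * sqn B.
Proof.
rewrite (sqnE (A *m B)) (sqnE A) (sqnE B) mulr_suml; apply: ler_sum => a _.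
rewrite [X in _ * X]exchange_big mulr_sumr /=; apply: ler_sum => b _.
by rewrite mxE; exact: cauchy_schwarz_sum.
Qed.

Lemma sqn_tr m n (A : 'M[R]_(m, n)) : sqn A^T = sqn A.
Proof.
by rewrite !sqnE exchange_big; do 2 (apply: eq_bigr => ? _); rewrite mxE.
Qed.

Lemma augmented_ge m n (L P : 'M[R]_(m, n)) b : 0 < b ->
  - (sqn L / (2 * b)) <= frob_inner L P + b / 2 * sqn P.
Proof.
move=> b0; have : 0 <= b / 2 * sqn (P + b^-1 *: L).
  by rewrite mulr_ge0 ?sqn_ge0 // divr_ge0 // ltW.
rewrite sqnD sqnZ frob_innerZr (frob_innerC P).
have -> : b / 2 * (sqn P + 2 * (b^-1 * frob_inner L P) + b^-1 ^+ 2 * sqn L) =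
  frob_inner L P + b / 2 * sqn P + sqn L / (2 * b) by field; rewrite gt_eqF.
lra.
Qed.

Lemma linear_coef_eq0 (b c : R) : (forall t, 0 <= t * b + t ^+ 2 * c) -> b = 0.
Proof.
move=> h; apply/eqP/negP => /negP b0.
have b2 : 0 < b ^+ 2 by rewrite exprn_even_gt0.
have K0 : 0 < `|c| + 1 by have : 0 <= `|c| by []; lra.
have cK : c <= `|c| + 1 by have := ler_norm c; lra.
move: (`|c| + 1) K0 cK => K K0 cK.
(* With [K = |c| + 1] this step is short enough for the linear term to dominate: the value is
   [b^2 (c - 2K) / (4 K^2)], which is negative because [c <= K]. *)
have := h (- b / (2 * K)).
have -> : - b / (2 * K) * b + (- b / (2 * K)) ^+ 2 * c =
   b ^+ 2 * (c - 2 * K) / (4 * K ^+ 2) by field; rewrite gt_eqF.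
apply/negP; rewrite -ltNge pmulr_llt0 ?invr_gt0 ?mulr_gt0 ?exprn_gt0 //.
by rewrite pmulr_rlt0 //; lra.
Qed.

(** For an objective that is exactly quadratic, minimality kills the linear term [G], and what
    remains of the expansion is the exact growth away from the minimiser. Stationarity and
    sufficient decrease of the [W] and [V] steps both come from here. *)
Lemma quadratic_min m n (h Q : 'M[R]_(m, n) -> R) (Z G : 'M[R]_(m, n)) :
  (forall D, h (Z + D) = h Z + frob_inner G D + Q D) ->
  (forall t D, Q (t *: D) = t ^+ 2 * Q D) ->
  (forall Z', h Z <= h Z') ->
  G = 0 /\ forall Z', h Z' = h Z + Q (Z' - Z).
Proof.
move=> hE QE hmin; have G0 : G = 0.
  apply: sqn0_eq0; apply: (@linear_coef_eq0 _ (Q G)) => t.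
  by have := hmin (Z + t *: G); rewrite hE QE frob_innerZr; lra.
split=> // Z'; rewrite -{1}[Z'](subrK Z) addrC hE G0 frob_inner0l; lra.
Qed.

Lemma ridge_min m n p (W : 'M[R]_(m, n)) (V : 'M[R]_(n, p)) (B : 'M[R]_(m, p)) (l b : R) :
  (forall W', l / 2 * sqn W + b / 2 * sqn (W *m V + B)
           <= l / 2 * sqn W' + b / 2 * sqn (W' *m V + B)) ->
  l *: W + b *: ((W *m V + B) *m V^T) = 0 /\
  forall W', l / 2 * sqn W' + b / 2 * sqn (W' *m V + B) =
    l / 2 * sqn W + b / 2 * sqn (W *m V + B)
    + (l / 2 * sqn (W' - W) + b / 2 * sqn ((W' - W) *m V)).
Proof.
apply: (@quadratic_min _ _ (fun W => l / 2 * sqn W + b / 2 * sqn (W *m V + B))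
  (fun D => l / 2 * sqn D + b / 2 * sqn (D *m V))) => [D|t D].
  rewrite /= (mulmxDl W D V) (addrAC (W *m V)) (sqnD W) (sqnD (W *m V + B)).
  rewrite (frob_innerDl (l *: W)) !frob_innerZl (frob_innerC (_ *m V^T)).
  by rewrite -frob_inner_mulr (frob_innerC (D *m V)); field.
by rewrite -scalemxAl !sqnZ; ring.
Qed.

(** The two weights [r] and [s] serve both kinds of [V] step: [r = s = mu] for the inner layers, and
    [s = 0] for layer [N - 1], which occurs in one residual only. *)
Lemma penalty_min m n p (Z A B : 'M[R]_(n, p)) (W : 'M[R]_(m, n)) (C : 'M[R]_(m, p))
    (r s b : R) :
  (forall Z', r / 2 * sqn (Z + A) + s / 2 * sqn (Z + B) + b / 2 * sqn (W *m Z + C)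
           <= r / 2 * sqn (Z' + A) + s / 2 * sqn (Z' + B) + b / 2 * sqn (W *m Z' + C)) ->
  r *: (Z + A) + s *: (Z + B) + b *: (W^T *m (W *m Z + C)) = 0 /\
  forall Z', r / 2 * sqn (Z' + A) + s / 2 * sqn (Z' + B) + b / 2 * sqn (W *m Z' + C) =
    r / 2 * sqn (Z + A) + s / 2 * sqn (Z + B) + b / 2 * sqn (W *m Z + C) +
    ((r + s) / 2 * sqn (Z' - Z) + b / 2 * sqn (W *m (Z' - Z))).
Proof.
apply: (@quadratic_min _ _ (fun Z => r / 2 * sqn (Z + A) + s / 2 * sqn (Z + B)
    + b / 2 * sqn (W *m Z + C))
  (fun D => (r + s) / 2 * sqn D + b / 2 * sqn (W *m D))) => [D|t D].
  rewrite /= (mulmxDr W Z D) (addrAC Z D A) (addrAC Z D B) (addrAC (W *m Z)).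
  rewrite (sqnD (Z + A)) (sqnD (Z + B)) (sqnD (W *m Z + C)).
  rewrite (frob_innerDl (_ + _)) (frob_innerDl (r *: _)) !frob_innerZl.
  by rewrite (frob_inner_mull W^T) trmxK; field.
by rewrite -scalemxAr !sqnZ; ring.
Qed.

End Frobenius.

(** * Derivatives along matrix curves and the gradient of the Lagrangian *)

Section MatrixDerivative.
Variable R : realType.

(** Entrywise derivatives along a real parameter suffice, since every partial derivative of the
    Lagrangian is defined along a line in one matrix entry. *)
Definition is_mderive m n (t0 : R) (A : R -> 'M[R]_(m, n)) (dA : 'M[R]_(m, n)) :=
  forall a b, is_derive t0 1 (fun t => A t a b) (dA a b).

Definition hmul m n (A B : 'M[R]_(m, n)) := \matrix_(a, b) (A a b * B a b).

Lemma frob_inner_hmul m n (A B C : 'M[R]_(m, n)) :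
  frob_inner A (hmul B C) = frob_inner (hmul A B) C.
Proof. by rewrite !frob_innerE; do 2 (apply: eq_bigr => ? _); rewrite !mxE; ring. Qed.

Lemma is_derive_addf (t0 df dg : R) (f g : R -> R) :
  is_derive t0 1 f df -> is_derive t0 1 g dg ->
  is_derive t0 1 (fun t => f t + g t) (df + dg).
Proof. by move=> ? ?; exact: is_deriveD. Qed.

Lemma is_derive_mulf (t0 df dg : R) (f g : R -> R) :
  is_derive t0 1 f df -> is_derive t0 1 g dg ->
  is_derive t0 1 (fun t => f t * g t) (df * g t0 + f t0 * dg).
Proof.
move=> hf hg; rewrite addrC (mulrC df).
exact: (@is_deriveM _ _ f g t0 1 df dg).
Qed.

Lemma is_derive_scalef (t0 df k : R) (f : R -> R) :
  is_derive t0 1 f df -> is_derive t0 1 (fun t => k * f t) (k * df).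
Proof. by move=> ?; exact: (@is_deriveZ _ _ _ f k). Qed.

Lemma is_derive_sumf (I : Type) (r : seq I) (P : pred I) (t0 : R)
    (f : I -> R -> R) (df : I -> R) :
  (forall i, P i -> is_derive t0 1 (f i) (df i)) ->
  is_derive t0 1 (fun t => \sum_(i <- r | P i) f i t) (\sum_(i <- r | P i) df i).
Proof.
move=> hf; elim: r => [|i r IH].
  have -> : (fun t => \sum_(i <- [::] | P i) f i t) = cst 0.
    by apply/funext => t; rewrite big_nil.
  by rewrite big_nil; exact: is_derive_cst.
rewrite big_cons; under eq_fun do rewrite big_cons.
by case: ifP => // Pi; apply: is_derive_addf => //; exact: hf.
Qed.

Lemma is_derive_sum_nat (k l : nat) (t0 : R) (f : nat -> R -> R) (df : nat -> R) :
  (forall i, (k <= i < l)%N -> is_derive t0 1 (f i) (df i)) ->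
  is_derive t0 1 (fun t => \sum_(k <= i < l) f i t) (\sum_(k <= i < l) df i).
Proof.
move=> hf; rewrite big_nat_cond; under eq_fun do rewrite big_nat_cond.
by apply: is_derive_sumf => i; rewrite andbT; exact: hf.
Qed.

Variables (m n : nat) (t0 : R).
Implicit Types A B : R -> 'M[R]_(m, n).

Lemma is_mderive_cst (M : 'M[R]_(m, n)) : is_mderive t0 (fun=> M) 0.
Proof. by move=> a b; rewrite mxE; exact: is_derive_cst. Qed.

Lemma is_mderive_line (M D : 'M[R]_(m, n)) : is_mderive t0 (fun t => M + t *: D) D.
Proof.
move=> a b.
have h := is_derive_addf (is_derive_cst (M a b) t0 1)
  (is_derive_scalef (D a b) (is_derive_id t0 1)).
rewrite add0r mulr1 in h.
have -> : (fun t => (M + t *: D) a b) = (fun t => cst (M a b) t + D a b * id t).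
  by apply/funext => t; rewrite !mxE mulrC.
exact: h.
Qed.

Lemma is_mderiveD A B dA dB : is_mderive t0 A dA -> is_mderive t0 B dB ->
  is_mderive t0 (fun t => A t + B t) (dA + dB).
Proof.
move=> hA hB a b; rewrite mxE; under eq_fun do rewrite mxE.
exact: is_derive_addf.
Qed.

Lemma is_mderiveN A dA : is_mderive t0 A dA -> is_mderive t0 (fun t => - A t) (- dA).
Proof.
move=> hA a b; rewrite mxE; under eq_fun do rewrite mxE.
exact: (@is_deriveN _ _ _ (fun t => A t a b)).
Qed.

Lemma is_mderive_act (s : R -> R) A dA : (forall x, derivable s x 1) ->
  is_mderive t0 A dA ->
  is_mderive t0 (fun t => act s (A t)) (hmul (act (derive1 s) (A t0)) dA).
Proof.
move=> ds hA a b; rewrite !mxE; under eq_fun do rewrite mxE.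
apply: (@is_derive1_comp _ s (fun t => A t a b)) => //.
by apply: DeriveDef => //; rewrite derive1E.
Qed.

Lemma is_derive_frob_inner A B dA dB : is_mderive t0 A dA -> is_mderive t0 B dB ->
  is_derive t0 1 (fun t => frob_inner (A t) (B t))
    (frob_inner dA (B t0) + frob_inner (A t0) dB).
Proof.
move=> hA hB; under eq_fun do rewrite frob_innerE.
rewrite !frob_innerE -big_split /=; apply: is_derive_sumf => a _.
by rewrite -big_split /=; apply: is_derive_sumf => b _; exact: is_derive_mulf.
Qed.

Lemma is_derive_sqn A dA : is_mderive t0 A dA ->
  is_derive t0 1 (fun t => sqn (A t)) (2 * frob_inner (A t0) dA).
Proof.
move=> hA; apply: (is_derive_eq (is_derive_frob_inner hA hA)).
by rewrite (frob_innerC dA); ring.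
Qed.

End MatrixDerivative.

Lemma is_mderive_mulmx (R : realType) m n p (t0 : R) (A : R -> 'M[R]_(m, n))
    (B : R -> 'M[R]_(n, p)) dA dB :
  is_mderive t0 A dA -> is_mderive t0 B dB ->
  is_mderive t0 (fun t => A t *m B t) (dA *m B t0 + A t0 *m dB).
Proof.
move=> hA hB a b; rewrite !mxE -big_split /=; under eq_fun do rewrite mxE.
by apply: is_derive_sumf => c _; exact: is_derive_mulf.
Qed.

Lemma is_mderive_upd (R : realType) m n (f : nat -> 'M[R]_(m, n)) i D j (t0 : R) :
  is_mderive t0 (fun t => upd f i (f i + t *: D) j) (if j == i then D else 0).
Proof.
by rewrite /upd; case: eqP => _; [exact: is_mderive_line | exact: is_mderive_cst].
Qed.

(** [V_i] occurs in the terms of layers [i] and [i+1]. This reindexing brings the term of layer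
    [i+1] to position [i]; the output layer [N], which has its own shape, supplies the boundary
    value [z]. *)
Lemma sum_nat_shift (R : realType) (f : nat -> R) (z : R) N : (1 < N)%N ->
  \sum_(1 <= i < N) f i + z
  = f 1%N + \sum_(1 <= i < N) (if i.+1 == N then z else f i.+1).
Proof.
case: N => [|[|M]] // _.
rewrite big_nat_recl // [in RHS]big_nat_recr //= eqxx -addrA; congr (_ + (_ + _)).
by apply: eq_big_nat => i /andP[_ iM]; rewrite eqSS ltn_eqF.
Qed.

Section Gradient.
Variables (R : realType) (d n q N : nat) (X : 'M[R]_(d, n)) (Y : 'M[R]_(q, n)).
Variables (lam mu : R) (beta : nat -> R) (sigma : nat -> R -> R).
Hypothesis N3 : (3 <= N)%N.
Hypothesis sigma_derivable : forall i, (1 <= i < N)%N -> forall x, derivable (sigma i) x 1.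
Notation state := (state R d n q).
Notation Lag := (Lag N X Y lam mu beta sigma).
Implicit Types s ds : state.

(** [mult] and [multN] below are the first-order multipliers: the derivative of
    [<Lam, P> + beta / 2 |P|^2] with respect to the constraint value [P]. *)
Definition resid s i := Vx X (sV s) i.-1 + act (sigma i) (sU s i) - Vx X (sV s) i.
Definition feas s i := sW s i *m Vx X (sV s) i.-1 - sU s i.
Definition feasN s := sWN s *m Vx X (sV s) N.-1 - sVN s.
Definition mult s i := sLam s i + beta i *: feas s i.
Definition multN s := sLamN s + beta N *: feasN s.

Definition gradW s i := lam *: sW s i + mult s i *m (Vx X (sV s) i.-1)^T.
Definition gradWN s := lam *: sWN s + multN s *m (Vx X (sV s) N.-1)^T.
Definition gradU s i := mu *: hmul (resid s i) (act (derive1 (sigma i)) (sU s i)) - mult s i.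
Definition gradV s i :=
  (if i.+1 == N then (sWN s)^T *m multN s
   else mu *: resid s i.+1 + (sW s i.+1)^T *m mult s i.+1) - mu *: resid s i.
Definition gradVN s := sVN s - Y - multN s.

(** The directional derivative of the Lagrangian at [s] along [ds]. It uses [Vx 0] for the direction
    because [V_0 = X] is fixed data. *)
Definition dLag s ds : R :=
  let dV := Vx 0 (sV ds) in
  frob_inner (sVN s - Y) (sVN ds)
  + lam * (\sum_(1 <= i < N) frob_inner (sW s i) (sW ds i) + frob_inner (sWN s) (sWN ds))
  + mu * \sum_(1 <= i < N) frob_inner (resid s i)
       (dV i.-1 + hmul (act (derive1 (sigma i)) (sU s i)) (sU ds i) - dV i)
  + \sum_(1 <= i < N) (frob_inner (feas s i) (sLam ds i) +
      frob_inner (mult s i) (sW ds i *m Vx X (sV s) i.-1 + sW s i *m dV i.-1 - sU ds i))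
  + frob_inner (feasN s) (sLamN ds)
  + frob_inner (multN s) (sWN ds *m Vx X (sV s) N.-1 + sWN s *m dV N.-1 - sVN ds).

Lemma is_derive_Lag (c : R -> state) ds :
  (forall i, is_mderive 0 (fun t => sW (c t) i) (sW ds i)) ->
  is_mderive 0 (fun t => sWN (c t)) (sWN ds) ->
  (forall i, is_mderive 0 (fun t => sU (c t) i) (sU ds i)) ->
  (forall i, is_mderive 0 (fun t => sV (c t) i) (sV ds i)) ->
  is_mderive 0 (fun t => sVN (c t)) (sVN ds) ->
  (forall i, is_mderive 0 (fun t => sLam (c t) i) (sLam ds i)) ->
  is_mderive 0 (fun t => sLamN (c t)) (sLamN ds) ->
  is_derive (0 : R) 1 (fun t => Lag (c t)) (dLag (c 0) ds).
Proof.
move=> hW hWN hU hV hVN hL hLN.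
have hVx i : is_mderive 0 (fun t => Vx X (sV (c t)) i) (Vx 0 (sV ds) i).
  by case: i => [|i] /=; [exact: is_mderive_cst | exact: hV].
have hfeas i := is_mderiveD (is_mderive_mulmx (hW i) (hVx i.-1)) (is_mderiveN (hU i)).
have hfeasN := is_mderiveD (is_mderive_mulmx hWN (hVx N.-1)) (is_mderiveN hVN).
have hY := is_mderiveD hVN (is_mderive_cst 0 (- Y)); rewrite addr0 in hY.
have hres i (iN : (1 <= i < N)%N) :=
  is_mderiveD (is_mderiveD (hVx i.-1) (is_mderive_act (sigma_derivable iN) (hU i)))
    (is_mderiveN (hVx i)).
have eterm i : frob_inner (sLam ds i) (feas (c 0) i)
    + frob_inner (sLam (c 0) i) (sW ds i *m Vx X (sV (c 0)) i.-1
      + sW (c 0) i *m Vx 0 (sV ds) i.-1 - sU ds i)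
    + beta i / 2 * (2 * frob_inner (feas (c 0) i) (sW ds i *m Vx X (sV (c 0)) i.-1
      + sW (c 0) i *m Vx 0 (sV ds) i.-1 - sU ds i))
    = frob_inner (feas (c 0) i) (sLam ds i) +
      frob_inner (mult (c 0) i) (sW ds i *m Vx X (sV (c 0)) i.-1
      + sW (c 0) i *m Vx 0 (sV ds) i.-1 - sU ds i).
  by rewrite /mult (frob_innerDl (sLam _ _)) frob_innerZl (frob_innerC (sLam ds i)); field.
have h1 := is_derive_scalef (1 / 2) (is_derive_sqn hY).
have h2 := is_derive_scalef (lam / 2) (is_derive_addf
  (@is_derive_sum_nat _ 1 N _ _ _ (fun i _ => is_derive_sqn (hW i))) (is_derive_sqn hWN)).
have h3 := is_derive_scalef (mu / 2)
  (@is_derive_sum_nat _ 1 N _ _ _ (fun i iN => is_derive_sqn (hres i iN))).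
have h4 i := is_derive_eq (is_derive_addf (is_derive_frob_inner (hL i) (hfeas i))
   (is_derive_scalef (beta i / 2) (is_derive_sqn (hfeas i)))) (eterm i).
have h5 := is_derive_frob_inner hLN hfeasN.
have h6 := is_derive_scalef (beta N / 2) (is_derive_sqn hfeasN).
apply: (is_derive_eq (is_derive_addf (is_derive_addf (is_derive_addf
  (is_derive_addf (is_derive_addf h1 h2) h3)
  (@is_derive_sum_nat _ 1 N _ _ _ (fun i _ => h4 i))) h5) h6)).
rewrite /dLag /resid -!mulr_sumr /multN (frob_innerDl (sLamN _)) frob_innerZl.
by rewrite (frob_innerC (sLamN ds)) /feasN; field.
Qed.

(** Collecting terms by block of [ds] reads off the gradient. The terms in the direction of
    [V_(i-1)] are moved to the block of index [i-1], which is why [gradV] distinguishes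
    [i.+1 == N]. *)
Lemma dLagE s ds :
  dLag s ds = \sum_(1 <= i < N) (frob_inner (gradW s i) (sW ds i)
     + frob_inner (gradU s i) (sU ds i) + frob_inner (gradV s i) (sV ds i)
     + frob_inner (feas s i) (sLam ds i))
   + frob_inner (gradWN s) (sWN ds) + frob_inner (gradVN s) (sVN ds)
   + frob_inner (feasN s) (sLamN ds).
Proof.
pose f i := mu * frob_inner (resid s i) (Vx 0 (sV ds) i.-1)
   + frob_inner (mult s i) (sW s i *m Vx 0 (sV ds) i.-1).
have f1 : f 1%N = 0 by rewrite /f /= mulmx0 !frob_inner0r; ring.
have e := sum_nat_shift f (frob_inner (multN s) (sWN s *m Vx 0 (sV ds) N.-1)) (ltnW N3).
rewrite f1 add0r in e.
pose g i := frob_inner (gradW s i) (sW ds i) + frob_inner (gradU s i) (sU ds i)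
  + frob_inner (feas s i) (sLam ds i) - mu * frob_inner (resid s i) (sV ds i).
have gE i : (1 <= i < N)%N -> lam * frob_inner (sW s i) (sW ds i)
    + mu * frob_inner (resid s i) (Vx 0 (sV ds) i.-1
        + hmul (act (derive1 (sigma i)) (sU s i)) (sU ds i) - Vx 0 (sV ds) i)
    + (frob_inner (feas s i) (sLam ds i) +
      frob_inner (mult s i) (sW ds i *m Vx X (sV s) i.-1 + sW s i *m Vx 0 (sV ds) i.-1 - sU ds i))
    = g i + f i.
  case: i => // i _; rewrite /g /f /gradW /gradU /=.
  move: (mult s i.+1) (resid s i.+1) (feas s i.+1) => M r F.
  rewrite !frob_innerDr !frob_innerNr !frob_innerDl !frob_innerZl !frob_innerNl.
  rewrite frob_inner_hmul (frob_innerC M (_ *m Vx _ _ _)) frob_inner_mulr.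
  by rewrite (frob_innerC (sW ds _)); ring.
have -> : dLag s ds = frob_inner (sVN s - Y) (sVN ds) + (\sum_(1 <= i < N) (g i + f i)
    + frob_inner (multN s) (sWN s *m Vx 0 (sV ds) N.-1))
  + lam * frob_inner (sWN s) (sWN ds)
  + frob_inner (feasN s) (sLamN ds)
  + frob_inner (multN s) (sWN ds *m Vx X (sV s) N.-1 - sVN ds).
  rewrite -(eq_big_nat _ _ gE) !big_split /= -!mulr_sumr /dLag.
  by rewrite !(frob_innerDr (_ + _) _ (multN s)) !frob_innerDr !big_split /=; ring.
rewrite big_split /= -(addrA (\sum_(1 <= i < N) g i)) e -big_split /=.
rewrite (eq_big_nat _ _ (F2 := fun i => frob_inner (gradW s i) (sW ds i)
     + frob_inner (gradU s i) (sU ds i) + frob_inner (gradV s i) (sV ds i)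
     + frob_inner (feas s i) (sLam ds i))); last first.
  case=> // i iN; rewrite /g /f /gradV /=.
  move: (gradW s i.+1) (gradU s i.+1) (resid s i.+1) (resid s i.+2) (mult s i.+2)
    (feas s i.+1) (multN s) => gW gU r r' M F MN.
  case: eqP => [<-|_] /=; rewrite !frob_innerDl !frob_innerNl !frob_innerZl.
    by rewrite (frob_inner_mull (sWN s)^T) trmxK; ring.
  by rewrite (frob_inner_mull (sW s _)^T) trmxK; ring.
rewrite /gradWN /gradVN.
move: (multN s) (feasN s) => MN F.
rewrite frob_innerDr !frob_innerDl !frob_innerNr !frob_innerNl frob_innerZl.
rewrite (frob_innerC MN (_ *m _)) frob_inner_mulr (frob_innerC (sWN ds)).
by ring.
Qed.

Let eta_state s : State (sW s) (sWN s) (sU s) (sV s) (sVN s) (sLam s) (sLamN s) = s.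
Proof. by case: s. Qed.

Let upd0 m p (f : nat -> 'M[R]_(m, p)) i D : upd f i (f i + 0 *: D) = f.
Proof. by apply/funext => j; rewrite /upd scale0r addr0; case: eqP => // ->. Qed.

Let sum1 i (f : nat -> R) : (1 <= i < N)%N -> (forall j, j != i -> f j = 0) ->
  \sum_(1 <= j < N) f j = f i.
Proof.
move=> iN f0; rewrite (bigD1_seq i) ?mem_index_iota ?iota_uniq //=.
by rewrite big1 ?addr0.
Qed.

(** The direction [ds] has one nonzero block, the elementary matrix [delta_mx a b], so [dLagE]
    collapses to a single entry. The six lemmas on the other blocks follow the same pattern. *)
Lemma dWE s i a b : (1 <= i < N)%N ->
  dW N X Y lam mu beta sigma s i a b = gradW s i a b.
Proof.
move=> iN; pose D := delta_mx a b : 'M[R]_(d, d).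
have := @is_derive_Lag (fun t => State (upd (sW s) i (sW s i + t *: D)) (sWN s) (sU s) (sV s) (sVN s) (sLam s) (sLamN s))
  (State (fun j => if j == i then D else 0) 0 (fun=> 0) (fun=> 0) 0 (fun=> 0) 0).
rewrite /dW derive1E => [[]]; try by move=> *; first [exact: is_mderive_upd | exact: is_mderive_cst].
move=> _ ->; rewrite /= upd0 eta_state dLagE /= !frob_inner0r.
rewrite (sum1 iN) => [|j /negPf ->]; rewrite !frob_inner0r ?addr0 //.
by rewrite ?add0r eqxx frob_inner_delta.
Qed.

Lemma dWNE s a b : dWN N X Y lam mu beta sigma s a b = gradWN s a b.
Proof.
pose D := delta_mx a b : 'M[R]_(q, d).
have := @is_derive_Lag (fun t => State (sW s) (sWN s + t *: D) (sU s) (sV s) (sVN s) (sLam s) (sLamN s))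
  (State (fun=> 0) D (fun=> 0) (fun=> 0) 0 (fun=> 0) 0).
rewrite /dWN derive1E => [[]]; try by move=> *; first [exact: is_mderive_line | exact: is_mderive_cst].
move=> _ ->; rewrite /= scale0r addr0 eta_state dLagE /= !frob_inner0r.
by rewrite big1 => [|j _]; rewrite ?frob_inner0r ?addr0 ?add0r ?frob_inner_delta.
Qed.

Lemma dUE s i a b : (1 <= i < N)%N ->
  dU N X Y lam mu beta sigma s i a b = gradU s i a b.
Proof.
move=> iN; pose D := delta_mx a b : 'M[R]_(d, n).
have := @is_derive_Lag (fun t => State (sW s) (sWN s) (upd (sU s) i (sU s i + t *: D)) (sV s) (sVN s) (sLam s) (sLamN s))
  (State (fun=> 0) 0 (fun j => if j == i then D else 0) (fun=> 0) 0 (fun=> 0) 0).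
rewrite /dU derive1E => [[]]; try by move=> *; first [exact: is_mderive_upd | exact: is_mderive_cst].
move=> _ ->; rewrite /= upd0 eta_state dLagE /= !frob_inner0r.
rewrite (sum1 iN) => [|j /negPf ->]; rewrite !frob_inner0r ?addr0 //.
by rewrite ?add0r eqxx frob_inner_delta.
Qed.

Lemma dVE s i a b : (1 <= i < N)%N ->
  dV N X Y lam mu beta sigma s i a b = gradV s i a b.
Proof.
move=> iN; pose D := delta_mx a b : 'M[R]_(d, n).
have := @is_derive_Lag (fun t => State (sW s) (sWN s) (sU s) (upd (sV s) i (sV s i + t *: D)) (sVN s) (sLam s) (sLamN s))
  (State (fun=> 0) 0 (fun=> 0) (fun j => if j == i then D else 0) 0 (fun=> 0) 0).
rewrite /dV derive1E => [[]]; try by move=> *; first [exact: is_mderive_upd | exact: is_mderive_cst].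
move=> _ ->; rewrite /= upd0 eta_state dLagE /= !frob_inner0r.
rewrite (sum1 iN) => [|j /negPf ->]; rewrite !frob_inner0r ?addr0 //.
by rewrite ?add0r eqxx frob_inner_delta.
Qed.

Lemma dVNE s a b : dVN N X Y lam mu beta sigma s a b = gradVN s a b.
Proof.
pose D := delta_mx a b : 'M[R]_(q, n).
have := @is_derive_Lag (fun t => State (sW s) (sWN s) (sU s) (sV s) (sVN s + t *: D) (sLam s) (sLamN s))
  (State (fun=> 0) 0 (fun=> 0) (fun=> 0) D (fun=> 0) 0).
rewrite /dVN derive1E => [[]]; try by move=> *; first [exact: is_mderive_line | exact: is_mderive_cst].
move=> _ ->; rewrite /= scale0r addr0 eta_state dLagE /= !frob_inner0r.
by rewrite big1 => [|j _]; rewrite ?frob_inner0r ?addr0 ?add0r ?frob_inner_delta.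
Qed.

Lemma dLamE s i a b : (1 <= i < N)%N ->
  dLam N X Y lam mu beta sigma s i a b = feas s i a b.
Proof.
move=> iN; pose D := delta_mx a b : 'M[R]_(d, n).
have := @is_derive_Lag (fun t => State (sW s) (sWN s) (sU s) (sV s) (sVN s) (upd (sLam s) i (sLam s i + t *: D)) (sLamN s))
  (State (fun=> 0) 0 (fun=> 0) (fun=> 0) 0 (fun j => if j == i then D else 0) 0).
rewrite /dLam derive1E => [[]]; try by move=> *; first [exact: is_mderive_upd | exact: is_mderive_cst].
move=> _ ->; rewrite /= upd0 eta_state dLagE /= !frob_inner0r.
rewrite (sum1 iN) => [|j /negPf ->]; rewrite !frob_inner0r ?addr0 //.
by rewrite ?add0r eqxx frob_inner_delta.
Qed.

Lemma dLamNE s a b : dLamN N X Y lam mu beta sigma s a b = feasN s a b.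
Proof.
pose D := delta_mx a b : 'M[R]_(q, n).
have := @is_derive_Lag (fun t => State (sW s) (sWN s) (sU s) (sV s) (sVN s) (sLam s) (sLamN s + t *: D))
  (State (fun=> 0) 0 (fun=> 0) (fun=> 0) 0 (fun=> 0) D).
rewrite /dLamN derive1E => [[]]; try by move=> *; first [exact: is_mderive_line | exact: is_mderive_cst].
move=> _ ->; rewrite /= scale0r addr0 eta_state dLagE /= !frob_inner0r.
by rewrite big1 => [|j _]; rewrite ?frob_inner0r ?addr0 ?add0r ?frob_inner_delta.
Qed.

Definition grad_sqn s :=
  \sum_(1 <= i < N) (sqn (gradW s i) + sqn (gradU s i) + sqn (gradV s i) + sqn (feas s i))
  + sqn (gradWN s) + sqn (gradVN s) + sqn (feasN s).

Lemma grad_normE s : grad_norm N X Y lam mu beta sigma s = Num.sqrt (grad_sqn s).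
Proof.
rewrite /grad_norm /grad_sqn (sqnE (gradWN s)) (sqnE (gradVN s)) (sqnE (feasN s)).
congr (Num.sqrt (_ + _ + _ + _)); last 3 first.
- by do 2 (apply: eq_bigr => ? _); rewrite dWNE.
- by do 2 (apply: eq_bigr => ? _); rewrite dVNE.
- by do 2 (apply: eq_bigr => ? _); rewrite dLamNE.
apply: eq_big_nat => i iN.
rewrite (sqnE (gradW s i)) (sqnE (gradU s i)) (sqnE (gradV s i)) (sqnE (feas s i)).
by congr (_ + _ + _ + _); do 2 (apply: eq_bigr => ? _); rewrite ?dWE ?dUE ?dVE ?dLamE.
Qed.

End Gradient.

(** * Block updates *)

Section BlockSteps.
Variables (R : realType) (lam mu b : R).
Hypothesis b0 : 0 < b.

Definition aug m n (L P : 'M[R]_(m, n)) : R := frob_inner L P + b / 2 * sqn P.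

(** Completing the square: the term [sqn L / (2 * b)] does not involve the block being minimised, so
    each subproblem of the algorithm differs from the Lagrangian by a constant, up to the proximal
    term. *)
Lemma augE m n (L P : 'M[R]_(m, n)) :
  b / 2 * sqn (P + b^-1 *: L) = aug L P + sqn L / (2 * b).
Proof.
rewrite /aug sqnD sqnZ frob_innerZr (frob_innerC P).
by field; rewrite gt_eqF.
Qed.

Lemma aug_multiplier_step m n (L P : 'M[R]_(m, n)) :
  aug (L + b *: P) P = aug L P + sqn (L + b *: P - L) / b.
Proof.
rewrite /aug [L + b *: P - L]addrC addKr frob_innerDl frob_innerZl sqnZ.
by field; rewrite gt_eqF.
Qed.

Lemma scaled_residual m n (L P : 'M[R]_(m, n)) : b *: (P + b^-1 *: L) = L + b *: P.
Proof. by rewrite scalerDr scalerA divff ?gt_eqF // scale1r addrC. Qed.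

Lemma W_step m n p (W : 'M[R]_(m, n)) (V : 'M[R]_(n, p)) (U L : 'M[R]_(m, p)) :
  (forall W', lam / 2 * sqn W
       + b / 2 * sqn (W *m V - U + b^-1 *: L)
     <= lam / 2 * sqn W' + b / 2 * sqn (W' *m V - U + b^-1 *: L)) ->
  lam *: W + (L + b *: (W *m V - U)) *m V^T = 0 /\
  forall W0, lam / 2 * sqn W + aug L (W *m V - U) + lam / 2 * sqn (W - W0)
    <= lam / 2 * sqn W0 + aug L (W0 *m V - U).
Proof.
move=> h; have [|G0 hW] := @ridge_min _ _ _ _ W V (- U + b^-1 *: L) lam b.
  by move=> W'; rewrite !addrA; exact: h.
split; first by rewrite -scaled_residual -scalemxAl -addrA.
move=> W0; have := hW W0; rewrite !(addrA (_ *m V)) !augE.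
have := sqn_ge0 ((W0 - W) *m V).
rewrite -(sqnN (W - W0)) opprB => Q0.
have : 0 <= b / 2 * sqn ((W0 - W) *m V) by rewrite mulr_ge0 // divr_ge0 // ltW.
lra.
Qed.

Lemma V_step m n p (Z A B : 'M[R]_(n, p)) (W : 'M[R]_(m, n)) (U L : 'M[R]_(m, p)) r s :
  (forall Z', r / 2 * sqn (Z + A) + s / 2 * sqn (Z + B)
       + b / 2 * sqn (W *m Z - U + b^-1 *: L)
     <= r / 2 * sqn (Z' + A) + s / 2 * sqn (Z' + B)
       + b / 2 * sqn (W *m Z' - U + b^-1 *: L)) ->
  r *: (Z + A) + s *: (Z + B) + W^T *m (L + b *: (W *m Z - U)) = 0 /\
  forall Z0, r / 2 * sqn (Z + A) + s / 2 * sqn (Z + B) + aug L (W *m Z - U)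
     + (r + s) / 2 * sqn (Z - Z0)
    <= r / 2 * sqn (Z0 + A) + s / 2 * sqn (Z0 + B) + aug L (W *m Z0 - U).
Proof.
move=> h; have [|G0 hZ] := @penalty_min _ _ _ _ Z A B W (- U + b^-1 *: L) r s b.
  by move=> Z'; rewrite !(addrA (W *m _)); exact: h.
split; first by rewrite -scaled_residual -scalemxAr -(addrA (W *m Z)).
move=> Z0; have := hZ Z0; rewrite !(addrA (W *m _)) !augE.
rewrite -(sqnN (Z - Z0)) opprB.
have : 0 <= b / 2 * sqn (W *m (Z0 - Z)).
  by rewrite mulr_ge0 ?sqn_ge0 // divr_ge0 // ltW.
lra.
Qed.

(** The activation makes this objective nonconvex, so there is no quadratic growth to exploit. The
    decrease comes only from comparison with [U0], where the proximal term vanishes, and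
    stationarity is derived separately by differentiation. *)
Lemma U_step m n (s : R -> R) (om : R) (U U0 A V P L : 'M[R]_(m, n)) :
  (forall x, derivable s x 1) ->
  (forall Z, mu / 2 * sqn (A + act s U - V) + b / 2 * sqn (U - P - b^-1 *: L)
       + om / 2 * sqn (U - U0)
     <= mu / 2 * sqn (A + act s Z - V) + b / 2 * sqn (Z - P - b^-1 *: L)
       + om / 2 * sqn (Z - U0)) ->
  L + b *: (P - U) = mu *: hmul (A + act s U - V) (act (derive1 s) U) + om *: (U - U0) /\
  mu / 2 * sqn (A + act s U - V) + aug L (P - U) + om / 2 * sqn (U - U0)
    <= mu / 2 * sqn (A + act s U0 - V) + aug L (P - U0).
Proof.
move=> ds h.
have e Z : Z - P - b^-1 *: L = - (P - Z + b^-1 *: L) by rewrite opprD opprB.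
split; last first.
  by have := h U0; rewrite !e !sqnN !augE subrr frob_inner0l; lra.
suff : mu *: hmul (A + act s U - V) (act (derive1 s) U) + om *: (U - U0)
    - (L + b *: (P - U)) = 0 by move/eqP; rewrite subr_eq0 => /eqP.
pose G := mu *: hmul (A + act s U - V) (act (derive1 s) U) + om *: (U - U0)
    - (L + b *: (P - U)).
apply: sqn0_eq0; rewrite -/G.
pose g Z := mu / 2 * sqn (A + act s Z - V) + b / 2 * sqn (Z - P - b^-1 *: L)
  + om / 2 * sqn (Z - U0).
have dg t := is_derive_addf (is_derive_addf
  (is_derive_scalef (mu / 2) (is_derive_sqn (is_mderiveD (is_mderiveD (is_mderive_cst t A)
     (is_mderive_act ds (is_mderive_line t U G))) (is_mderive_cst t (- V)))))
  (is_derive_scalef (b / 2) (is_derive_sqn (is_mderiveD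
     (is_mderiveD (is_mderive_line t U G) (is_mderive_cst t (- P)))
     (is_mderive_cst t (- (b^-1 *: L)))))))
  (is_derive_scalef (om / 2) (is_derive_sqn
     (is_mderiveD (is_mderive_line t U G) (is_mderive_cst t (- U0))))).
(* The line through [U] in the direction of the gradient [G] itself: the derivative at 0 is [sqn G],
   and it vanishes at a minimum. *)
rewrite -(is_derive_at_min (f := fun t => g (U + t *: G)) _ (dg 0)); last 2 first.
- by move=> t; have [] := dg t.
- by move=> t; rewrite scale0r addr0; exact: h.
rewrite !add0r !addr0 scale0r addr0 e (frob_inner_hmul _ _ G) frob_innerNl.
rewrite {1}/G !frob_innerDl !frob_innerZl !frob_innerNl.
move: (hmul _ _) => H; rewrite (frob_innerDl L) (frob_innerDl U) frob_innerZl.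
by rewrite (frob_innerDl P) !frob_innerNl; field; rewrite gt_eqF.
Qed.

(** The closed form is the stationary point of a quadratic whose Hessian is [1 + b] times the
    identity, hence an equality instead of a bound. The first conclusion identifies the updated
    multiplier with [VN - Y]. *)
Lemma VN_step m n (VN Y P L : 'M[R]_(m, n)) :
  VN = (1 + b)^-1 *: (Y + b *: P + L) ->
  L + b *: (P - VN) = VN - Y /\
  forall VN0, 1 / 2 * sqn (VN - Y) + aug L (P - VN) + (1 + b) / 2 * sqn (VN - VN0)
    = 1 / 2 * sqn (VN0 - Y) + aug L (P - VN0).
Proof.
move=> hVN; have e : L + b *: (P - VN) = VN - Y.
  have : (1 + b) *: VN = Y + b *: P + L.
    by rewrite hVN scalerA divff ?scale1r // gt_eqF // ltr_wpDl.
  rewrite scalerDl scale1r => h; apply/eqP; rewrite -subr_eq0.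
  rewrite scalerBr; move/eqP: h; rewrite -subr_eq0 => /eqP h; apply/eqP.
  by rewrite -[RHS]oppr0 -h; apply/matrixP => i j; rewrite !mxE; ring.
split=> // VN0.
have -> : L = VN - Y - b *: (P - VN) by rewrite -e addrK.
have -> : P - VN0 = (P - VN) + (VN - VN0) by rewrite addrA subrK.
have -> : VN0 - Y = (VN - Y) - (VN - VN0) by rewrite [RHS]addrC opprB addrA subrK.
rewrite /aug; move: (P - VN) (VN - VN0) (VN - Y) => p v y.
rewrite !frob_lin (frob_innerC y p) (frob_innerC y v) (frob_innerC p v).
by field.
Qed.

End BlockSteps.

(** * Sequences dominated by a given sequence *)

Section Domination.
Variables (R : realType) (E : nat -> R).

(** A big-O with a constant uniform in [k]. The choice [E = 1] expresses boundedness, so products of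
    bounded and dominated matrices stay in one calculus. *)
Definition dominated (f : nat -> R) := exists2 C : R, 0 <= C & forall k, f k <= C * E k.

Lemma dominated_le (f g : nat -> R) :
  (forall k, f k <= g k) -> dominated g -> dominated f.
Proof. by move=> fg [C C0 gE]; exists C => // k; exact: le_trans (gE k). Qed.

Lemma dominatedD f g : dominated f -> dominated g -> dominated (fun k => f k + g k).
Proof.
move=> [C C0 fE] [D D0 gE]; exists (C + D); first exact: addr_ge0.
by move=> k; rewrite mulrDl lerD.
Qed.

Lemma dominatedZ c f : 0 <= c -> dominated f -> dominated (fun k => c * f k).
Proof.
move=> c0 [C C0 fE]; exists (c * C); first exact: mulr_ge0.
by move=> k; rewrite -mulrA ler_wpM2l.
Qed.

Lemma dominated_sum_nat (a b : nat) (f : nat -> nat -> R) :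
  (forall i, (a <= i < b)%N -> dominated (f i)) ->
  dominated (fun k => \sum_(a <= i < b) f i k).
Proof.
move=> fE.
suff : forall l, (l <= b)%N -> dominated (fun k => \sum_(a <= i < l) f i k) by exact.
elim=> [_|l IH lb]; first by exists 0 => // k; rewrite big_geq // mul0r.
have [al|la] := leqP a l; last by exists 0 => // k; rewrite big_geq // mul0r.
apply: (@dominated_le _ (fun k => \sum_(a <= i < l) f i k + f l k)).
  by move=> k; rewrite big_nat_recr.
by apply: dominatedD; [exact/IH/ltnW | apply: fE; rewrite al].
Qed.

Definition mdominated m n (M : nat -> 'M[R]_(m, n)) := dominated (fun k => sqn (M k)).

Lemma mdominatedD m n (A B : nat -> 'M[R]_(m, n)) :
  mdominated A -> mdominated B -> mdominated (fun k => A k + B k).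
Proof.
move=> hA hB; apply: (@dominated_le _ (fun k => 2 * (sqn (A k) + sqn (B k)))).
  by move=> k; exact: sqnD_le.
by apply: dominatedZ => //; exact: dominatedD.
Qed.

Lemma mdominatedN m n (A : nat -> 'M[R]_(m, n)) :
  mdominated A -> mdominated (fun k => - A k).
Proof. by apply: dominated_le => k; rewrite sqnN. Qed.

Lemma mdominatedB m n (A B : nat -> 'M[R]_(m, n)) :
  mdominated A -> mdominated B -> mdominated (fun k => A k - B k).
Proof. by move=> hA hB; apply: mdominatedD => //; exact: mdominatedN. Qed.

Lemma mdominatedZ m n c (A : nat -> 'M[R]_(m, n)) :
  mdominated A -> mdominated (fun k => c *: A k).
Proof.
move=> hA; apply: (dominated_le _ (dominatedZ (sqr_ge0 c) hA)) => k.
by rewrite sqnZ.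
Qed.

Lemma mdominated_entrywise m n c (A B : nat -> 'M[R]_(m, n)) :
  (forall k a b, `|A k a b| <= c * `|B k a b|) -> mdominated B -> mdominated A.
Proof.
move=> AB hB; apply: (dominated_le _ (dominatedZ (sqr_ge0 c) hB)) => k.
exact: sqn_le_entrywise.
Qed.

End Domination.

Notation bounded_mx M := (mdominated (fun=> 1) M).

Lemma mdominated_tr (R : realType) (E : nat -> R) m n (A : nat -> 'M[R]_(m, n)) :
  mdominated E A -> mdominated E (fun k => (A k)^T).
Proof. by apply: dominated_le => k; rewrite sqn_tr. Qed.

Lemma mdominated_mull (R : realType) (E : nat -> R) m n p
    (A : nat -> 'M[R]_(m, n)) (B : nat -> 'M[R]_(n, p)) :
  bounded_mx A -> mdominated E B -> mdominated E (fun k => A k *m B k).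
Proof.
move=> [C C0 hA] hB; apply: (dominated_le _ (dominatedZ C0 hB)) => k.
apply: le_trans (sqn_mulmx_le _ _) _; apply: ler_wpM2r; first exact: sqn_ge0.
by have := hA k; rewrite mulr1.
Qed.

Lemma mdominated_mulr (R : realType) (E : nat -> R) m n p
    (A : nat -> 'M[R]_(m, n)) (B : nat -> 'M[R]_(n, p)) :
  mdominated E A -> bounded_mx B -> mdominated E (fun k => A k *m B k).
Proof.
move=> /mdominated_tr hA /mdominated_tr hB.
have := mdominated_tr (mdominated_mull hB hA).
by apply: dominated_le => k; rewrite trmx_mul !trmxK.
Qed.

(** * From square summability to averages and minima *)

Section Averages.
Variables (R : realType) (g : nat -> R) (S : R).
Hypothesis g0 : forall k, 0 <= g k.
Hypothesis gS : forall k, \sum_(1 <= l < k.+1) g l ^+ 2 <= S.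

(** Cauchy-Schwarz against the constant 1 gives [(sum g)^2 <= k S]. Taking [S + 1] makes the
    constant positive even when [S = 0]. *)
Lemma average_le k : (0 < k)%N ->
  k%:R^-1 * \sum_(1 <= l < k.+1) g l <= Num.sqrt (S + 1) / Num.sqrt k%:R.
Proof.
move=> k0; have kR : 0 < k%:R :> R by rewrite ltr0n.
have S0 : 0 <= S by apply: le_trans (gS 0); rewrite big_geq.
have h : (\sum_(1 <= l < k.+1) g l) ^+ 2 <= k%:R * S.
  have := cauchy_schwarz_sum (fun i : 'I_k => g i.+1) (fun=> 1).
  under eq_bigr do rewrite mulr1.
  rewrite big_add1 big_mkord => /le_trans; apply.
  rewrite expr1n sumr_const card_ord mulrC; apply: ler_wpM2l => //.
  by have := gS k; rewrite big_add1 big_mkord.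
rewrite ler_pdivrMl // mulrA ler_pdivlMr ?sqrtr_gt0 // -[X in X * Num.sqrt (S + 1)](sqr_sqrtr (ltW kR)).
have s0 : 0 < Num.sqrt k%:R :> R by rewrite sqrtr_gt0.
rewrite expr2 [leRHS]mulrAC ler_pM2r //.
have : Num.sqrt ((\sum_(1 <= l < k.+1) g l) ^+ 2) <= Num.sqrt (k%:R * (S + 1)).
  by apply: ler_wsqrtr; apply: le_trans h _; rewrite ler_pM2l // lerDl.
by rewrite sqrtr_sqr sqrtrM ?(ltW kR) // ger0_norm // sumr_ge0.
Qed.

(** The default value [g 1%N] is itself a term of the range when [0 < k], so the iterated minimum is
    the genuine one; it lies below each of the [k] terms, hence below their mean. *)
Lemma bigmin_le_average k : (0 < k)%N ->
  \big[Num.min/g 1%N]_(1 <= l < k.+1) g l <= k%:R^-1 * \sum_(1 <= l < k.+1) g l.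
Proof.
move=> k0; rewrite ler_pdivlMl ?ltr0n //.
have -> : k%:R * \big[Num.min/g 1%N]_(1 <= l < k.+1) g l =
    \sum_(1 <= l < k.+1) \big[Num.min/g 1%N]_(1 <= l < k.+1) g l.
  by rewrite sumr_const_nat subn1 mulr_natl.
rewrite big_nat_cond [leRHS]big_nat_cond; apply: ler_sum => l; rewrite andbT => lk.
by apply: ge_bigmin_seq; rewrite ?mem_index_iota.
Qed.

End Averages.

(** The [W] step is stationary for the old data [v], [L], [U], while the gradient is taken at the
    new data. Writing [M], [M'] for the old and new first-order multipliers, the gradient is [M'
    v'^T - M v^T = M' (v' - v)^T + (M' - M) v^T], where every product contains an increment. *)
Lemma ridge_gradient_shift (R : realType) m n p (lam b : R) (W : 'M[R]_(m, n))
    (v v' : 'M[R]_(n, p)) (L L' U U' : 'M[R]_(m, p)) :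
  lam *: W + (L + b *: (W *m v - U)) *m v^T = 0 ->
  (L' + b *: (W *m v' - U')) *m (v' - v)^T
    + (L' - L + b *: (W *m (v' - v) - (U' - U))) *m v^T
  = lam *: W + (L' + b *: (W *m v' - U')) *m v'^T.
Proof.
move/eqP; rewrite addr_eq0 => /eqP ->.
have -> : L' - L + b *: (W *m (v' - v) - (U' - U)) =
    (L' + b *: (W *m v' - U')) - (L + b *: (W *m v - U)).
  by rewrite mulmxDr mulmxN; move: (W *m v) (W *m v') => w w';
     apply/matrixP => x y; rewrite !mxE; ring.
by rewrite [(v' - v)^T]linearB /= mulmxBr mulmxBl addrA subrK addrC.
Qed.

(** * The iteration *)

Section ADMM.
Variables (R : realType) (d n q N : nat) (X : 'M[R]_(d, n)) (Y : 'M[R]_(q, n)).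
Variables (lam mu : R) (beta : nat -> R) (sigma : nat -> R -> R).
Variables (psi0 psi1 psi2 : R) (Vmax a omin : nat -> R) (omega : nat -> nat -> R).
Variable Xs : nat -> state R d n q.
Hypothesis N3 : (3 <= N)%N.
Hypotheses (lam0 : 0 < lam) (mu0 : 0 < mu).
Hypothesis beta0 : forall i, (1 <= i <= N)%N -> 0 < beta i.
Hypotheses (psi00 : 0 < psi0) (psi10 : 0 < psi1) (psi20 : 0 < psi2).
Hypothesis sigma_derivable : forall i, (1 <= i < N)%N -> forall x, derivable (sigma i) x 1.
Hypothesis sigma_bounded : forall i, (1 <= i < N)%N -> forall x, `|sigma i x| <= psi0.
Hypothesis dsigma_bounded : forall i, (1 <= i < N)%N -> forall x, `|derive1 (sigma i) x| <= psi1.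
Hypothesis sigma_lipschitz : forall i, (1 <= i < N)%N -> forall x y,
  `|sigma i x - sigma i y| <= psi1 * `|x - y|.
Hypothesis dsigma_lipschitz : forall i, (1 <= i < N)%N -> forall x y,
  `|derive1 (sigma i) x - derive1 (sigma i) y| <= psi2 * `|x - y|.
Hypothesis V_bounded : forall i k, (i < N)%N -> frob (Vx X (sV (Xs k)) i) <= Vmax i.
Hypothesis aE : forall i,
  a i = psi0 * psi2 + psi1 ^+ 2 + Vmax i * psi2 + Vmax i.-1 * psi2.
Hypothesis beta_large : forall i, (1 <= i < N)%N -> 16 * mu * psi1 ^+ 2 < beta i.
Hypothesis betaN_gt1 : 1 < beta N.
Hypothesis omin0 : forall i, (1 <= i < N)%N -> 0 < omin i.
Hypothesis omega_ge : forall i k, (1 <= i < N)%N -> omin i <= omega i k.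
Hypothesis omega_quadratic : forall i k, (1 <= i < N)%N ->
  8 * omega i k ^+ 2 + 8 * mu * a i * omega i k + 4 * mu ^+ 2 * a i ^+ 2
    <= beta i * omega i k / 4.
Hypothesis admm : is_3s_ppADMM N X Y lam mu beta sigma omega Xs.

Notation W k := (sW (Xs k)).
Notation WN k := (sWN (Xs k)).
Notation U k := (sU (Xs k)).
Notation V k := (Vx X (sV (Xs k))).
Notation VN k := (sVN (Xs k)).
Notation L k := (sLam (Xs k)).
Notation LN k := (sLamN (Xs k)).

Let betaN0 : 0 < beta N.
Proof. exact: lt_trans betaN_gt1. Qed.

Let betai0 i : (1 <= i < N)%N -> 0 < beta i.
Proof. by move=> /andP[i1 iN]; apply: beta0; rewrite i1 ltnW. Qed.

(** * Optimality condition and decrease for each block of one sweep *)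

Lemma W_update k i : (1 <= i < N)%N ->
  lam *: W k.+1 i + (L k i + beta i *: (W k.+1 i *m V k i.-1 - U k i)) *m (V k i.-1)^T = 0
  /\ lam / 2 * sqn (W k.+1 i) + aug (beta i) (L k i) (W k.+1 i *m V k i.-1 - U k i)
       + lam / 2 * sqn (W k.+1 i - W k i)
     <= lam / 2 * sqn (W k i) + aug (beta i) (L k i) (W k i *m V k i.-1 - U k i).
Proof.
move=> iN; have [_ [_ [_ /(_ k.+1 isT)[hW _]]]] := admm.
by have [-> h] := W_step (betai0 iN) (hW _ iN); split=> //; exact: h.
Qed.

Lemma WN_update k :
  lam *: WN k.+1 + (LN k + beta N *: (WN k.+1 *m V k N.-1 - VN k)) *m (V k N.-1)^T = 0
  /\ lam / 2 * sqn (WN k.+1) + aug (beta N) (LN k) (WN k.+1 *m V k N.-1 - VN k)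
       + lam / 2 * sqn (WN k.+1 - WN k)
     <= lam / 2 * sqn (WN k) + aug (beta N) (LN k) (WN k *m V k N.-1 - VN k).
Proof.
have [_ [_ [_ /(_ k.+1 isT)[_ [hW _]]]]] := admm.
by have [-> h] := W_step betaN0 hW; split=> //; exact: h.
Qed.

Lemma Lam_update k i : (1 <= i < N)%N ->
  L k.+1 i = L k i + beta i *: (W k.+1 i *m V k.+1 i.-1 - U k.+1 i).
Proof.
have [_ [_ [_ /(_ k.+1 isT)[_ [_ [_ [_ [_ [_ [h _]]]]]]]]]] := admm.
exact: h.
Qed.

Lemma LamN_update k :
  LN k.+1 = LN k + beta N *: (WN k.+1 *m V k.+1 N.-1 - VN k.+1).
Proof.
by have [_ [_ [_ /(_ k.+1 isT)[_ [_ [_ [_ [_ [_ [_ h]]]]]]]]]] := admm.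
Qed.

Lemma U_update k i : (1 <= i < N)%N ->
  L k.+1 i = mu *: hmul (V k.+1 i.-1 + act (sigma i) (U k.+1 i) - V k i)
                        (act (derive1 (sigma i)) (U k.+1 i))
             + omega i k *: (U k.+1 i - U k i)
  /\ mu / 2 * sqn (V k.+1 i.-1 + act (sigma i) (U k.+1 i) - V k i)
       + aug (beta i) (L k i) (W k.+1 i *m V k.+1 i.-1 - U k.+1 i)
       + omega i k / 2 * sqn (U k.+1 i - U k i)
     <= mu / 2 * sqn (V k.+1 i.-1 + act (sigma i) (U k i) - V k i)
       + aug (beta i) (L k i) (W k.+1 i *m V k.+1 i.-1 - U k i).
Proof.
move=> iN; have [_ [_ [_ /(_ k.+1 isT)[_ [_ [hU _]]]]]] := admm.
by have [h1 h2] := U_step (betai0 iN) (sigma_derivable iN) (hU _ iN); rewrite Lam_update.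
Qed.

Lemma V_update k i : (1 <= i)%N -> (i.+1 < N)%N ->
  mu *: (V k.+1 i - (V k.+1 i.-1 + act (sigma i) (U k.+1 i)))
  + mu *: (V k.+1 i + act (sigma i.+1) (U k i.+1) - V k i.+1)
  + (W k.+1 i.+1)^T *m (L k i.+1 + beta i.+1 *: (W k.+1 i.+1 *m V k.+1 i - U k i.+1)) = 0
  /\ mu / 2 * sqn (V k.+1 i.-1 + act (sigma i) (U k.+1 i) - V k.+1 i)
       + mu / 2 * sqn (V k.+1 i + act (sigma i.+1) (U k i.+1) - V k i.+1)
       + aug (beta i.+1) (L k i.+1) (W k.+1 i.+1 *m V k.+1 i - U k i.+1)
       + mu * sqn (V k.+1 i - V k i)
     <= mu / 2 * sqn (V k.+1 i.-1 + act (sigma i) (U k.+1 i) - V k i)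
       + mu / 2 * sqn (V k i + act (sigma i.+1) (U k i.+1) - V k i.+1)
       + aug (beta i.+1) (L k i.+1) (W k.+1 i.+1 *m V k i - U k i.+1).
Proof.
move=> i1 iN; have [_ [_ [_ /(_ k.+1 isT)[_ [_ [_ [hV _]]]]]]] := admm.
have iN2 : (i <= N - 2)%N by rewrite leq_subRL 1?addnC ?addn2 // (leq_trans _ N3).
have {}hV := hV i i1 iN2; rewrite /= in hV.
have e (A B Z : 'M[R]_(d, n)) : sqn (A + B - Z) = sqn (Z + - (A + B)).
  by rewrite -sqnN opprB.
have bi0 : 0 < beta i.+1 by apply: betai0.
have [|h1 h2] := @V_step _ _ bi0 _ _ _ (V k.+1 i)
  (- (V k.+1 i.-1 + act (sigma i) (U k.+1 i))) (act (sigma i.+1) (U k i.+1) - V k i.+1)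
  (W k.+1 i.+1) (U k i.+1) (L k i.+1) mu mu.
  by move=> Z; have := hV Z; rewrite !(e (V k.+1 i.-1)) !(addrA _ (act _ _)).
split; first by move: h1; rewrite !(addrA _ (act _ _)).
have := h2 (V k i); rewrite !(addrA _ (act _ _)) !(e (V k.+1 i.-1)).
have -> : (mu + mu) / 2 = mu by field.
by [].
Qed.

(** [V_(N-1)] enters a single residual and gains [mu / 2], whereas an inner block enters two and
    gains [mu]. *)
Lemma V_last_update k :
  mu *: (V k.+1 N.-1 - (V k.+1 N.-2 + act (sigma N.-1) (U k.+1 N.-1)))
  + (WN k.+1)^T *m (LN k + beta N *: (WN k.+1 *m V k.+1 N.-1 - VN k)) = 0
  /\ mu / 2 * sqn (V k.+1 N.-2 + act (sigma N.-1) (U k.+1 N.-1) - V k.+1 N.-1)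
       + aug (beta N) (LN k) (WN k.+1 *m V k.+1 N.-1 - VN k)
       + mu / 2 * sqn (V k.+1 N.-1 - V k N.-1)
     <= mu / 2 * sqn (V k.+1 N.-2 + act (sigma N.-1) (U k.+1 N.-1) - V k N.-1)
       + aug (beta N) (LN k) (WN k.+1 *m V k N.-1 - VN k).
Proof.
have [_ [_ [_ /(_ k.+1 isT)[_ [_ [_ [_ [hV _]]]]]]]] := admm.
rewrite /= in hV.
have e (A B Z : 'M[R]_(d, n)) : sqn (A + B - Z) = sqn (Z + - (A + B)).
  by rewrite -sqnN opprB.
have e' (A B Z : 'M[R]_(d, n)) : Z - A - B = Z + - (A + B) by rewrite opprD addrA.
have [|h1 h2] := @V_step _ _ betaN0 _ _ _ (V k.+1 N.-1)
  (- (V k.+1 N.-2 + act (sigma N.-1) (U k.+1 N.-1))) 0 (WN k.+1) (VN k) (LN k) mu 0.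
  by move=> Z; have := hV Z; rewrite !e' !mul0r !addr0.
split; first by move: h1; rewrite scale0r addr0.
by have := h2 (V k N.-1); rewrite !mul0r !addr0 !e.
Qed.

Lemma VN_update k :
  LN k.+1 = VN k.+1 - Y /\
  1 / 2 * sqn (VN k.+1 - Y) + aug (beta N) (LN k) (WN k.+1 *m V k.+1 N.-1 - VN k.+1)
     + (1 + beta N) / 2 * sqn (VN k.+1 - VN k)
  = 1 / 2 * sqn (VN k - Y) + aug (beta N) (LN k) (WN k.+1 *m V k.+1 N.-1 - VN k).
Proof.
have [_ [_ [_ /(_ k.+1 isT)[_ [_ [_ [_ [_ [hV _]]]]]]]]] := admm.
by have [h1 h2] := VN_step betaN0 hV; rewrite LamN_update.
Qed.

(** * Descent of the Lagrangian and of the potential *)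

Let dW2 k i := sqn (W k.+1 i - W k i).
Let dU2 k i := sqn (U k.+1 i - U k i).
Let dV2 k i := sqn (V k.+1 i - V k i).
Let dL2 k i := sqn (L k.+1 i - L k i).
Let dWN2 k := sqn (WN k.+1 - WN k).
Let dVN2 k := sqn (VN k.+1 - VN k).
Let dLN2 k := sqn (LN k.+1 - LN k).
Notation Lg k := (Lag N X Y lam mu beta sigma (Xs k)).

Let LagE k : Lg k = 1 / 2 * sqn (VN k - Y)
  + \sum_(1 <= i < N) (lam / 2 * sqn (W k i)) + lam / 2 * sqn (WN k)
  + \sum_(1 <= i < N) (mu / 2 * sqn (V k i.-1 + act (sigma i) (U k i) - V k i))
  + \sum_(1 <= i < N) aug (beta i) (L k i) (W k i *m V k i.-1 - U k i)
  + aug (beta N) (LN k) (WN k *m V k N.-1 - VN k).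
Proof. by rewrite /Lag /aug -!mulr_sumr; ring. Qed.

Lemma Lag_descent k :
  Lg k.+1
  + \sum_(1 <= i < N) (lam / 2 * dW2 k i + omega i k / 2 * dU2 k i
      + (if i.+1 == N then mu / 2 else mu) * dV2 k i)
  + lam / 2 * dWN2 k + (1 + beta N) / 2 * dVN2 k
  <= Lg k + \sum_(1 <= i < N) dL2 k i / beta i + dLN2 k / beta N.
Proof.
(* The [i]-th terms of the Lagrangian at successive stages of one sweep; the
   [V_i]-step changes terms [i] and [i.+1], so the stages of neighbouring
   indices are chained by [sum_nat_shift]. *)
pose P0 i := aug (beta i) (L k i) (W k i *m V k i.-1 - U k i).
pose P1 i := aug (beta i) (L k i) (W k.+1 i *m V k i.-1 - U k i).
pose P3 i := aug (beta i) (L k i) (W k.+1 i *m V k.+1 i.-1 - U k.+1 i).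
pose P4 i := aug (beta i) (L k.+1 i) (W k.+1 i *m V k.+1 i.-1 - U k.+1 i).
pose R0 i := mu / 2 * sqn (V k i.-1 + act (sigma i) (U k i) - V k i).
pose S2 i := mu / 2 * sqn (V k.+1 i.-1 + act (sigma i) (U k i) - V k i)
  + aug (beta i) (L k i) (W k.+1 i *m V k.+1 i.-1 - U k i).
pose T i := mu / 2 * sqn (V k.+1 i.-1 + act (sigma i) (U k.+1 i) - V k i).
pose R3 i := mu / 2 * sqn (V k.+1 i.-1 + act (sigma i) (U k.+1 i) - V k.+1 i).
pose Q1 := aug (beta N) (LN k) (WN k.+1 *m V k N.-1 - VN k).
pose Q2 := aug (beta N) (LN k) (WN k.+1 *m V k.+1 N.-1 - VN k).
pose w k i := lam / 2 * sqn (W k i).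
have sW : \sum_(1 <= i < N) w k.+1 i + \sum_(1 <= i < N) P1 i
    + \sum_(1 <= i < N) lam / 2 * dW2 k i
    <= \sum_(1 <= i < N) w k i + \sum_(1 <= i < N) P0 i.
  rewrite -!big_split; apply: ler_sum_nat => i iN /=.
  exact: (W_update k iN).2.
have sU : \sum_(1 <= i < N) T i + \sum_(1 <= i < N) P3 i
    + \sum_(1 <= i < N) omega i k / 2 * dU2 k i <= \sum_(1 <= i < N) S2 i.
  rewrite -!big_split; apply: ler_sum_nat => i iN /=.
  exact: (U_update k iN).2.
have sV : \sum_(1 <= i < N) R3 i
    + \sum_(1 <= i < N) (if i.+1 == N then Q2 else S2 i.+1)
    + \sum_(1 <= i < N) (if i.+1 == N then mu / 2 else mu) * dV2 k i
    <= \sum_(1 <= i < N) T i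
      + \sum_(1 <= i < N) (if i.+1 == N then Q1 else R0 i.+1 + P1 i.+1).
  rewrite -!big_split; apply: ler_sum_nat => i /andP[i1 iN] /=.
  case: eqP => [e|/eqP ne].
    have := (V_last_update k).2; rewrite /Q2 /Q1 /R3 /T /dV2.
    by have -> : N.-1 = i by rewrite -e.
  have iN' : (i.+1 < N)%N by rewrite ltn_neqAle ne.
  by have := (V_update k i1 iN').2; rewrite /S2 /R0 /P1 /R3 /T /dV2 /=; lra.
have e1 := sum_nat_shift S2 Q2 (ltnW N3).
have e2 := sum_nat_shift (fun i => R0 i + P1 i) Q1 (ltnW N3).
(* The chain over the layers starts here: [V_0 = X] at every iteration, so no [V] step precedes
   layer 1. *)
have e3 : S2 1%N = R0 1%N + P1 1%N by [].
rewrite big_split /= in e2.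
have sL : \sum_(1 <= i < N) P4 i = \sum_(1 <= i < N) P3 i + \sum_(1 <= i < N) dL2 k i / beta i.
  rewrite -big_split; apply: eq_big_nat => i iN.
  by rewrite /P4 /dL2 Lam_update // aug_multiplier_step // betai0.
have sLN : aug (beta N) (LN k.+1) (WN k.+1 *m V k.+1 N.-1 - VN k.+1)
   = aug (beta N) (LN k) (WN k.+1 *m V k.+1 N.-1 - VN k.+1) + dLN2 k / beta N.
  by rewrite /dLN2 LamN_update aug_multiplier_step.
have sWN := (WN_update k).2.
have sVN := (VN_update k).2.
have E0 : Lg k = 1 / 2 * sqn (VN k - Y) + \sum_(1 <= i < N) w k i + lam / 2 * sqn (WN k)
  + \sum_(1 <= i < N) R0 i + \sum_(1 <= i < N) P0 i
  + aug (beta N) (LN k) (WN k *m V k N.-1 - VN k) := LagE k.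
have E1 : Lg k.+1 = 1 / 2 * sqn (VN k.+1 - Y) + \sum_(1 <= i < N) w k.+1 i
  + lam / 2 * sqn (WN k.+1) + \sum_(1 <= i < N) R3 i + \sum_(1 <= i < N) P4 i
  + aug (beta N) (LN k.+1) (WN k.+1 *m V k.+1 N.-1 - VN k.+1) := LagE k.+1.
rewrite -/(dWN2 k) -/Q1 in sWN; rewrite -/(dVN2 k) -/Q2 in sVN.
have eD : \sum_(1 <= i < N) (lam / 2 * dW2 k i + omega i k / 2 * dU2 k i
      + (if i.+1 == N then mu / 2 else mu) * dV2 k i) =
    \sum_(1 <= i < N) lam / 2 * dW2 k i + \sum_(1 <= i < N) omega i k / 2 * dU2 k i
    + \sum_(1 <= i < N) (if i.+1 == N then mu / 2 else mu) * dV2 k i.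
  by rewrite !big_split.
rewrite E0 E1 sLN sL eD.
lra.
Qed.

Let omega0 i k : (1 <= i < N)%N -> 0 < omega i k.
Proof. by move=> iN; apply: lt_le_trans (omega_ge k iN); exact: omin0. Qed.

Let V_entry k i x y : (i < N)%N -> `|V k i x y| <= Vmax i.
Proof. by move=> iN; apply: le_trans (entry_le_frob _ _ _) _; exact: V_bounded. Qed.

Let pred_lt i : (1 <= i < N)%N -> (i.-1 < N)%N.
Proof. by case: i => // i /andP[_ /ltnW]. Qed.

(** [a i] is a Lipschitz constant of [u |-> (v + sigma_i u - w) * sigma_i' u] for [|v| <= Vmax i.-1]
    and [|w| <= Vmax i]: the product rule gives [psi1 ^+ 2 + (Vmax i.-1 + psi0 + Vmax i) * psi2].
    The index starts at [k.+1] because the formula for the multiplier is available from the first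
    iteration on, not at the initial point. *)
Lemma dual_increment_le k i : (1 <= i < N)%N ->
  dL2 k.+1 i <= 4 * ((mu * a i + omega i k.+1) ^+ 2 * dU2 k.+1 i
     + omega i k ^+ 2 * dU2 k i
     + mu ^+ 2 * psi1 ^+ 2 * dV2 k.+1 i.-1 + mu ^+ 2 * psi1 ^+ 2 * dV2 k i).
Proof.
move=> iN; pose s := sigma i; pose s' := derive1 (sigma i).
(* The increment is telescoped one argument at a time: [A1] changes [U] and takes the new proximal
   term, [A2] is the old proximal term, [A3] and [A4] change [V_(i-1)] and [V_i]. *)
pose A1 := mu *: (hmul (V k.+2 i.-1 + act s (U k.+2 i) - V k.+1 i) (act s' (U k.+2 i))
    - hmul (V k.+2 i.-1 + act s (U k.+1 i) - V k.+1 i) (act s' (U k.+1 i)))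
    + omega i k.+1 *: (U k.+2 i - U k.+1 i).
pose A2 := - omega i k *: (U k.+1 i - U k i).
pose A3 := mu *: hmul (V k.+2 i.-1 - V k.+1 i.-1) (act s' (U k.+1 i)).
pose A4 := - mu *: hmul (V k.+1 i - V k i) (act s' (U k.+1 i)).
have -> : dL2 k.+1 i = sqn (A1 + A2 + (A3 + A4)).
  rewrite /dL2 (U_update k.+1 iN).1 (U_update k iN).1; congr (frob_inner _ _);
  by rewrite /A1 /A2 /A3 /A4 /s /s'; apply/matrixP => x y; rewrite !mxE; ring.
apply: le_trans (sqnD4_le _ _ _ _) _; rewrite ler_pM2l //.
have hs' M : forall x y, `|hmul M (act s' (U k.+1 i)) x y| <= psi1 * `|M x y|.
  move=> x y; rewrite !mxE normrM mulrC ler_wpM2r //.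
  exact: dsigma_bounded.
apply: lerD; [apply: lerD; [apply: lerD|]|].
- apply: sqn_le_entrywise => x y; rewrite !mxE.
  set u' := U k.+2 i x y; set u := U k.+1 i x y.
  set v := V k.+2 i.-1 x y; set w := V k.+1 i x y.
  have hv : `|v| <= Vmax i.-1 by apply: V_entry; exact: pred_lt.
  have hw : `|w| <= Vmax i by apply: V_entry; case/andP: iN.
  have h0 := sigma_bounded iN u; have h1 := dsigma_bounded iN u'.
  have h2 := sigma_lipschitz iN u' u; have h3 := dsigma_lipschitz iN u' u.
  have om0 := omega0 k.+1 iN.
  rewrite [leRHS]mulrDl; apply: (le_trans (ler_normD _ _)).
  apply: lerD; last by rewrite normrM gtr0_norm.
  rewrite normrM gtr0_norm // -mulrA ler_pM2l //.
  have -> : (v + s u' - w) * s' u' - (v + s u - w) * s' u =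
     (s u' - s u) * s' u' + (v + s u - w) * (s' u' - s' u) by ring.
  apply: (le_trans (ler_normD _ _)); rewrite !normrM aE.
  have e1 : `|s u' - s u| * `|s' u'| <= psi1 * `|u' - u| * psi1 by apply: ler_pM.
  have e3 : `|v + s u - w| <= Vmax i.-1 + psi0 + Vmax i.
    apply: (le_trans (ler_normB _ _)); apply: lerD => //.
    by apply: (le_trans (ler_normD _ _)); apply: lerD.
  have e2 : `|v + s u - w| * `|s' u' - s' u|
      <= (Vmax i.-1 + psi0 + Vmax i) * (psi2 * `|u' - u|) by apply: ler_pM.
  apply: (le_trans (lerD e1 e2)).
  by rewrite le_eqVlt; apply/orP; left; apply/eqP; ring.
- by rewrite /A2 sqnZ sqrrN.
- by rewrite /A3 sqnZ -mulrA ler_wpM2l ?sqr_ge0 // sqn_le_entrywise.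
- by rewrite /A4 sqnZ sqrrN -mulrA ler_wpM2l ?sqr_ge0 // sqn_le_entrywise.
Qed.

Let cU k i := 4 * omega i k ^+ 2 / beta i.
Let cV i := 4 * mu ^+ 2 * psi1 ^+ 2 / beta i.
Let cN := (1 + beta N) / 2 - (beta N)^-1.

Let cN0 : 0 < cN.
Proof.
have : (beta N)^-1 < 1 by rewrite invf_lt1.
by rewrite /cN; move: ((beta N)^-1) => z z1; have := betaN_gt1; lra.
Qed.

Let cV0 i : (1 <= i < N)%N -> 0 <= cV i <= mu / 4.
Proof.
move=> iN; have b0 := betai0 iN; apply/andP; split.
  by rewrite /cV !mulr_ge0 ?sqr_ge0 ?invr_ge0 // ltW.
rewrite /cV ler_pdivrMr //; have := beta_large iN => h.
have : mu * (16 * mu * psi1 ^+ 2) <= mu * beta i by rewrite ler_pM2l // ltW.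
lra.
Qed.

Definition Phi k : R := Lg k.+1 + \sum_(1 <= i < N) (cU k i * dU2 k i + cV i * dV2 k i).

Definition Drop k : R :=
  \sum_(1 <= i < N) (lam / 2 * dW2 k i + omin i / 4 * dU2 k i + mu / 4 * dV2 k i)
  + lam / 2 * dWN2 k + cN * dVN2 k.

Let dLN2E k : dLN2 k.+1 = dVN2 k.+1.
Proof.
by rewrite /dLN2 /dVN2 !(VN_update _).1 opprB addrA subrK.
Qed.

(** The stored terms of [Phi k] pay for the older increments in [dual_increment_le]; those of
    [Phi k.+1] are bought from the current gain. The charge on [V_(i-1)] must first be moved to
    index [i-1], its first term being zero since [V_0] is constant. *)
Lemma Phi_descent k : Phi k.+1 + Drop k.+1 <= Phi k.
Proof.
have h := Lag_descent k.+1.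
have V0 : cV 1 * dV2 k.+1 0 = 0 by rewrite /dV2 /= subrr frob_inner0l mulr0.
have sh := sum_nat_shift (fun i => cV i * dV2 k.+1 i.-1) 0 (ltnW N3).
rewrite addr0 V0 add0r /= in sh.
suff key : \sum_(1 <= i < N) (cU k.+1 i * dU2 k.+1 i + cV i * dV2 k.+1 i)
    + \sum_(1 <= i < N) (lam / 2 * dW2 k.+1 i + omin i / 4 * dU2 k.+1 i + mu / 4 * dV2 k.+1 i)
    + \sum_(1 <= i < N) dL2 k.+1 i / beta i
    + \sum_(1 <= i < N) (if i.+1 == N then 0 else cV i.+1 * dV2 k.+1 i)
  <= \sum_(1 <= i < N) (cU k i * dU2 k i + cV i * dV2 k i)
    + \sum_(1 <= i < N) (lam / 2 * dW2 k.+1 i + omega i k.+1 / 2 * dU2 k.+1 i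
      + (if i.+1 == N then mu / 2 else mu) * dV2 k.+1 i)
    + \sum_(1 <= i < N) cV i * dV2 k.+1 i.-1.
  rewrite /Phi /Drop; rewrite dLN2E in h.
  have : cN * dVN2 k.+1 = (1 + beta N) / 2 * dVN2 k.+1 - dVN2 k.+1 / beta N.
    by rewrite /cN; ring.
  lra.
rewrite -!big_split; apply: ler_sum_nat => i iN /=.
have b0 := betai0 iN.
have hd : dL2 k.+1 i / beta i <= 4 * (mu * a i + omega i k.+1) ^+ 2 / beta i * dU2 k.+1 i
    + cU k i * dU2 k i + cV i * dV2 k.+1 i.-1 + cV i * dV2 k i.
  rewrite ler_pdivrMr //; apply: le_trans (dual_increment_le k iN) _.
  rewrite le_eqVlt; apply/orP; left; apply/eqP; rewrite /cU /cV.
  by field; rewrite gt_eqF.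
(* [omega_quadratic] divided by [beta i] bounds the first two summands by [omega i k.+1 / 4]; the
   other quarter covers [omin i / 4]. *)
have hU : (4 * (mu * a i + omega i k.+1) ^+ 2 / beta i + cU k.+1 i + omin i / 4) * dU2 k.+1 i
    <= omega i k.+1 / 2 * dU2 k.+1 i.
  apply: ler_wpM2r; first exact: sqn_ge0.
  have := omega_quadratic k.+1 iN; have := omega_ge k.+1 iN.
  have -> : 4 * (mu * a i + omega i k.+1) ^+ 2 / beta i + cU k.+1 i =
    (8 * omega i k.+1 ^+ 2 + 8 * mu * a i * omega i k.+1 + 4 * mu ^+ 2 * a i ^+ 2) / beta i.
    by rewrite /cU; field; rewrite gt_eqF.
  move=> h1 h2.
  have : (8 * omega i k.+1 ^+ 2 + 8 * mu * a i * omega i k.+1 + 4 * mu ^+ 2 * a i ^+ 2) / beta i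
     <= omega i k.+1 / 4.
    by rewrite ler_pdivrMr //; lra.
  lra.
(* Each [cV] is at most [mu / 4]. The last layer gains only [mu / 2] but bears one charge; inner
   layers bear two and gain [mu]. *)
have hV : (cV i + mu / 4) * dV2 k.+1 i + (if i.+1 == N then 0 else cV i.+1 * dV2 k.+1 i)
   <= (if i.+1 == N then mu / 2 else mu) * dV2 k.+1 i.
  have v0 : 0 <= dV2 k.+1 i by exact: sqn_ge0.
  have /andP[_ c1] := cV0 iN.
  case: eqP => [_|/eqP ne]; rewrite -?mulrDl ?addr0; apply: ler_wpM2r => //; first by lra.
  have /andP[_ c2] : 0 <= cV i.+1 <= mu / 4.
    by apply: cV0; rewrite /= ltn_neqAle ne; case/andP: iN.
  by have := mu0; lra.
rewrite mulrDl mulrDl in hU; rewrite mulrDl in hV.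
move: hd hU hV; rewrite /dL2 /dU2 /dV2 /cU /cV /dW2.
move: (sqn (L _ _ - _) / _) (4 * (_ + _) ^+ 2 / _ * _) => l z.
case: ifP => _; lra.
Qed.

(** * Lower bound of the potential and boundedness of the iterates *)

Let Vmax0 i : (i < N)%N -> 0 <= Vmax i.
Proof. by move=> iN; apply: le_trans (V_bounded 0 iN); exact: sqrtr_ge0. Qed.

Let a0 i : (1 <= i < N)%N -> 0 <= a i.
Proof.
move=> iN; have v1 := Vmax0 (pred_lt iN).
have v2 : 0 <= Vmax i by apply: Vmax0; case/andP: iN.
have h1 : 0 <= psi0 * psi2 by apply: mulr_ge0; apply: ltW.
have h2 : 0 <= psi1 ^+ 2 by exact: sqr_ge0.
have h3 : 0 <= Vmax i * psi2 by apply: mulr_ge0 => //; apply: ltW.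
have h4 : 0 <= Vmax i.-1 * psi2 by apply: mulr_ge0 => //; apply: ltW.
by rewrite aE; lra.
Qed.

(** Dropping nonnegative terms from [omega_quadratic] leaves [8 omega^2 <= beta omega / 4]. The
    crude bound by [beta i] makes coefficients containing [omega i k] uniform in [k]. *)
Let omega_le i k : (1 <= i < N)%N -> omega i k <= beta i.
Proof.
move=> iN; have o0 := omega0 k iN; have := omega_quadratic k iN.
have : 0 <= mu * a i * omega i k.
  by apply: mulr_ge0; [apply: mulr_ge0; [exact: ltW | exact: a0] | exact: ltW].
have : 0 <= mu ^+ 2 * a i ^+ 2 by apply: mulr_ge0; exact: sqr_ge0.
move=> h1 h2 h3; have : omega i k * (8 * omega i k) <= omega i k * (beta i / 4) by lra.
by rewrite ler_pM2l // => h; have := betai0 iN; lra.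
Qed.

Let CL i : R := 2 * (mu ^+ 2 * (((Vmax i.-1 + psi0 + Vmax i) * psi1) ^+ 2
  * sqn (const_mx 1 : 'M[R]_(d, n)))).

Lemma Lam_sqn_le k i : (1 <= i < N)%N ->
  sqn (L k.+1 i) <= CL i + 2 * (omega i k ^+ 2 * dU2 k i).
Proof.
move=> iN; rewrite (U_update k iN).1; apply: le_trans (sqnD_le _ _) _.
rewrite /CL -mulrDr ler_pM2l // !sqnZ lerD2r ler_wpM2l ?sqr_ge0 //.
(* Comparison with the all-ones matrix turns the uniform entry bound into a bound on the squared
   norm. *)
apply: sqn_le_entrywise => x y; rewrite !mxE normr1 mulr1 normrM.
apply: ler_pM => //; last exact: dsigma_bounded.
apply: (le_trans (ler_normB _ _)); apply: lerD; last by apply: V_entry; case/andP: iN.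
apply: (le_trans (ler_normD _ _)); apply: lerD; last exact: sigma_bounded.
by apply: V_entry; exact: pred_lt.
Qed.

Let Cinf := \sum_(1 <= i < N) CL i / (2 * beta i).

(** Only the pairings with multipliers can be negative; completing the square bounds them by
    [- sqn L / (2 * beta i)]. By [Lam_sqn_le] this uses one of the four units [omega^2 / beta] in
    [cU], leaving three. For the output layer [LN = VN - Y], and [beta N > 1] lets the data term
    absorb the loss. *)
Lemma Phi_ge k :
  \sum_(1 <= i < N) (lam / 2 * sqn (W k.+1 i)) + lam / 2 * sqn (WN k.+1)
  + \sum_(1 <= i < N) (3 * omega i k ^+ 2 / beta i * dU2 k i)
  + (1 - (beta N)^-1) / 2 * sqn (VN k.+1 - Y) <= Phi k + Cinf.
Proof.
rewrite /Phi LagE /Cinf.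
have hN := augmented_ge (LN k.+1) (WN k.+1 *m V k.+1 N.-1 - VN k.+1) betaN0.
rewrite -/(aug _ _ _) {1}(VN_update k).1 in hN.
have -> : (1 - (beta N)^-1) / 2 * sqn (VN k.+1 - Y)
   = 1 / 2 * sqn (VN k.+1 - Y) - sqn (VN k.+1 - Y) / (2 * beta N).
  by field; rewrite gt_eqF.
suff : \sum_(1 <= i < N) (3 * omega i k ^+ 2 / beta i * dU2 k i) <=
   \sum_(1 <= i < N) (mu / 2 * sqn (V k.+1 i.-1 + act (sigma i) (U k.+1 i) - V k.+1 i))
   + \sum_(1 <= i < N) aug (beta i) (L k.+1 i) (W k.+1 i *m V k.+1 i.-1 - U k.+1 i)
   + \sum_(1 <= i < N) (cU k i * dU2 k i + cV i * dV2 k i)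
   + \sum_(1 <= i < N) CL i / (2 * beta i).
  by move: hN; rewrite (VN_update k).1; lra.
rewrite -!big_split; apply: ler_sum_nat => i iN /=; have b0 := betai0 iN.
have h1 : 0 <= mu / 2 * sqn (V k.+1 i.-1 + act (sigma i) (U k.+1 i) - V k.+1 i).
  by rewrite mulr_ge0 ?sqn_ge0 // divr_ge0 // ltW.
have h2 := augmented_ge (L k.+1 i) (W k.+1 i *m V k.+1 i.-1 - U k.+1 i) b0.
rewrite -/(aug _ _ _) in h2.
have h3 : 0 <= cV i * dV2 k i.
  by rewrite mulr_ge0 ?sqn_ge0 //; case/andP: (cV0 iN).
have h4 : sqn (L k.+1 i) / (2 * beta i) <=
    CL i / (2 * beta i) + omega i k ^+ 2 / beta i * dU2 k i.
  rewrite ler_pdivrMr ?mulr_gt0 //; apply: le_trans (Lam_sqn_le k iN) _.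
  by rewrite le_eqVlt; apply/orP; left; apply/eqP; field; rewrite gt_eqF.
have h5 : cU k i * dU2 k i = 4 * (omega i k ^+ 2 / beta i * dU2 k i).
  by rewrite /cU !mulrA.
have h6 : 3 * omega i k ^+ 2 / beta i * dU2 k i = 3 * (omega i k ^+ 2 / beta i * dU2 k i).
  by rewrite !mulrA.
move: h2 h4; rewrite h5 h6; move: (omega i k ^+ 2 / _ * _) => z.
move: (_ / (2 * beta i)) (CL i / _) => l c h2 h4.
lra.
Qed.

Lemma Drop_ge0 k : 0 <= Drop k.
Proof.
have h (c x : R) : 0 < c -> 0 <= x -> 0 <= c * x by move=> *; apply: mulr_ge0 => //; exact: ltW.
have l0 : 0 < lam / 2 by have := lam0; lra.
have m0 : 0 < mu / 4 by have := mu0; lra.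
rewrite /Drop; apply: addr_ge0; last by apply: h; rewrite ?sqn_ge0.
apply: addr_ge0; last by apply: h; rewrite ?sqn_ge0.
rewrite big_nat_cond; apply: sumr_ge0 => i; rewrite andbT => iN.
have o0 : 0 < omin i / 4 by have := omin0 iN; lra.
by do 2 (apply: addr_ge0; last by apply: h; rewrite ?sqn_ge0); apply: h; rewrite ?sqn_ge0.
Qed.

Lemma Phi_sum k : Phi k + \sum_(l < k) Drop l.+1 <= Phi 0.
Proof.
elim: k => [|k IH]; first by rewrite big_ord0 addr0.
by rewrite big_ord_recr /=; have := Phi_descent k; lra.
Qed.

Let Phi_le k : Phi k <= Phi 0.
Proof.
have := Phi_sum k; have : 0 <= \sum_(l < k) Drop l.+1.
  by apply: sumr_ge0 => l _; exact: Drop_ge0.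
lra.
Qed.

Let le_sum_nat (f : nat -> R) i : (forall j, (1 <= j < N)%N -> 0 <= f j) ->
  (1 <= i < N)%N -> f i <= \sum_(1 <= j < N) f j.
Proof.
move=> f0 iN; rewrite (bigD1_seq i) ?mem_index_iota ?iota_uniq //= lerDl.
by rewrite big_nat_cond; apply: sumr_ge0 => j /andP[jN _]; exact: f0.
Qed.

Let K := Phi 0 + Cinf.

Let betaN_inv : 0 < 1 - (beta N)^-1.
Proof. by rewrite subr_gt0 invf_lt1. Qed.

Lemma iterates_bounded k :
  [/\ forall i, (1 <= i < N)%N -> lam / 2 * sqn (W k.+1 i) <= K,
      lam / 2 * sqn (WN k.+1) <= K,
      forall i, (1 <= i < N)%N -> 3 * omega i k ^+ 2 / beta i * dU2 k i <= K
    & (1 - (beta N)^-1) / 2 * sqn (VN k.+1 - Y) <= K].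
Proof.
have h := Phi_ge k; have h' := Phi_le k; rewrite /K.
have fW i : (1 <= i < N)%N -> 0 <= lam / 2 * sqn (W k.+1 i).
  by move=> _; rewrite mulr_ge0 ?sqn_ge0 // divr_ge0 // ltW.
have fU i : (1 <= i < N)%N -> 0 <= 3 * omega i k ^+ 2 / beta i * dU2 k i.
  move=> iN; have b0 := ltW (betai0 iN); apply: mulr_ge0; last exact: sqn_ge0.
  by apply: divr_ge0 => //; apply: mulr_ge0 => //; exact: sqr_ge0.
have fWN : 0 <= lam / 2 * sqn (WN k.+1) by rewrite mulr_ge0 ?sqn_ge0 // divr_ge0 // ltW.
have fVN : 0 <= (1 - (beta N)^-1) / 2 * sqn (VN k.+1 - Y).
  by rewrite mulr_ge0 ?sqn_ge0 // divr_ge0 // ltW.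
have sW0 : 0 <= \sum_(1 <= i < N) (lam / 2 * sqn (W k.+1 i)).
  by rewrite big_nat_cond; apply: sumr_ge0 => i; rewrite andbT; exact: fW.
have sU0 : 0 <= \sum_(1 <= i < N) (3 * omega i k ^+ 2 / beta i * dU2 k i).
  by rewrite big_nat_cond; apply: sumr_ge0 => i; rewrite andbT; exact: fU.
split=> [i iN||i iN|].
- by have := le_sum_nat fW iN; lra.
- lra.
- by have := le_sum_nat fU iN; lra.
- lra.
Qed.

Lemma Drop_ge k :
  (forall i, (1 <= i < N)%N ->
     omin i / 4 * dU2 k i <= Drop k /\ mu / 4 * dV2 k i <= Drop k)
  /\ cN * dVN2 k <= Drop k.
Proof.
have h (c x : R) : 0 < c -> 0 <= x -> 0 <= c * x by move=> *; apply: mulr_ge0 => //; exact: ltW.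
have l0 : 0 < lam / 2 by have := lam0; lra.
have m0 : 0 < mu / 4 by have := mu0; lra.
have p1 : 0 <= lam / 2 * dWN2 k by apply: h; rewrite ?sqn_ge0.
have p2 : 0 <= cN * dVN2 k by apply: h; rewrite ?sqn_ge0.
have qq i : (1 <= i < N)%N -> [/\ 0 <= lam / 2 * dW2 k i, 0 <= omin i / 4 * dU2 k i
    & 0 <= mu / 4 * dV2 k i].
  move=> iN; have o0 : 0 < omin i / 4 by have := omin0 iN; lra.
  by split; apply: h; rewrite ?sqn_ge0.
pose f i := lam / 2 * dW2 k i + omin i / 4 * dU2 k i + mu / 4 * dV2 k i.
have f0 i : (1 <= i < N)%N -> 0 <= f i.
  by move=> /qq[q1 q2 q3]; rewrite /f; apply: addr_ge0 => //; exact: addr_ge0.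
have s0 : 0 <= \sum_(1 <= i < N) f i.
  by rewrite big_nat_cond; apply: sumr_ge0 => i; rewrite andbT; exact: f0.
rewrite /Drop -/(\sum_(1 <= i < N) f i); split; last by lra.
move=> i iN; have := le_sum_nat f0 iN; have [q1 q2 q3] := qq i iN.
by rewrite {1}/f => hs; split; lra.
Qed.

(** * Control of the gradient by the increments *)

(** The gradient at [Xs k.+2] involves increments from [k.+1] to [k.+2] and, through the
    multipliers, from [k] to [k.+1]; hence two consecutive drops. *)
Let E k := Drop k + Drop k.+1.

Let dominated_Drop (f : nat -> R) c : 0 < c -> (forall k, c * f k <= Drop k) ->
  dominated E f /\ dominated E (fun k => f k.+1).
Proof.
move=> c0 h; split; exists c^-1; rewrite ?invr_ge0 ?ltW // => k; rewrite ler_pdivlMl // /E.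
  by have := h k; have := Drop_ge0 k.+1; lra.
by have := h k.+1; have := Drop_ge0 k; lra.
Qed.

Let lam2 : 0 < lam / 2. Proof. by have := lam0; lra. Qed.
Let mu4 : 0 < mu / 4. Proof. by have := mu0; lra. Qed.

Let mdU i : (1 <= i < N)%N -> mdominated E (fun k => U k.+2 i - U k.+1 i) /\
  mdominated E (fun k => U k.+1 i - U k i).
Proof.
move=> iN; have o4 : 0 < omin i / 4 by have := omin0 iN; lra.
have [] := dominated_Drop (f := fun k => dU2 k i) o4; last by split.
by move=> k; have [/(_ i iN)[]] := Drop_ge k.
Qed.

Let mdV i : (i < N)%N -> mdominated E (fun k => V k.+2 i - V k.+1 i) /\
  mdominated E (fun k => V k.+1 i - V k i).
Proof.
case: i => [_|i iN].
  by split; exists 0 => // k; rewrite /= subrr frob_inner0l mul0r.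
have [] := dominated_Drop (f := fun k => dV2 k i.+1) mu4; last by split.
by move=> k; have [/(_ i.+1 iN)[]] := Drop_ge k.
Qed.

Let mdVN : mdominated E (fun k => VN k.+2 - VN k.+1).
Proof.
by apply: (dominated_Drop (f := dVN2) cN0 _).2 => k; have [_ ?] := Drop_ge k.
Qed.

Let mdLN : mdominated E (fun k => LN k.+2 - LN k.+1).
Proof. by apply: dominated_le mdVN => k; have := dLN2E k; rewrite /dLN2 /dVN2 => ->. Qed.

Let mdL i : (1 <= i < N)%N -> mdominated E (fun k => L k.+2 i - L k.+1 i).
Proof.
move=> iN; have [U1 U2] := mdU iN; have [V1 _] := mdV (pred_lt iN).
have iN' : (i < N)%N by case/andP: iN.
have [_ V2] := mdV iN'; have ai := a0 iN; have b0 := betai0 iN.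
have m2 : 0 <= mu ^+ 2 * psi1 ^+ 2 by apply: mulr_ge0; exact: sqr_ge0.
apply: (dominated_le (fun k => dual_increment_le k iN)).
apply: dominatedZ => //; apply: dominatedD; last exact: dominatedZ.
apply: dominatedD; last exact: dominatedZ.
apply: dominatedD.
- apply: (dominated_le _ (dominatedZ (sqr_ge0 (mu * a i + beta i)) U1)) => k.
  apply: ler_wpM2r; first exact: sqn_ge0.
  have m0 : 0 <= mu * a i by apply: mulr_ge0 => //; exact: ltW.
  have o0 := omega0 k.+1 iN; have o1 := omega_le k.+1 iN.
  by apply: lerXn2r; rewrite ?nnegrE; lra.
- apply: (dominated_le _ (dominatedZ (sqr_ge0 (beta i)) U2)) => k.
  apply: ler_wpM2r; first exact: sqn_ge0.
  have o0 := omega0 k iN; have o1 := omega_le k iN.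
  by apply: lerXn2r; rewrite ?nnegrE; lra.
Qed.

Let bounded_le m p (M : nat -> 'M[R]_(m, p)) C : (forall k, sqn (M k) <= C) -> bounded_mx M.
Proof.
move=> h; exists C; first exact: le_trans (sqn_ge0 _) (h 0).
by move=> k; rewrite mulr1.
Qed.

Let bW i : (1 <= i < N)%N -> bounded_mx (fun k => W k.+1 i).
Proof.
move=> iN; apply: (@bounded_le _ _ _ ((lam / 2)^-1 * K)) => k.
by rewrite ler_pdivlMl //; have [h _ _ _] := iterates_bounded k; exact: h.
Qed.

Let bWN : bounded_mx (fun k => WN k.+1).
Proof.
apply: (@bounded_le _ _ _ ((lam / 2)^-1 * K)) => k.
by rewrite ler_pdivlMl //; have [_ h _ _] := iterates_bounded k; exact: h.
Qed.

Let bL i : (1 <= i < N)%N -> bounded_mx (fun k => L k.+1 i).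
Proof.
move=> iN; have b0 := betai0 iN.
apply: (@bounded_le _ _ _ (CL i + 2 * (beta i / 3 * K))) => k.
apply: le_trans (Lam_sqn_le k iN) _; rewrite lerD2l ler_pM2l //.
have [_ _ /(_ i iN) h _] := iterates_bounded k.
have b3 : 0 < beta i / 3 by lra.
rewrite -(ler_pM2l b3) in h; apply: (le_trans _ h).
by rewrite le_eqVlt; apply/orP; left; apply/eqP; field; rewrite gt_eqF.
Qed.

Let bLN : bounded_mx (fun k => LN k.+1).
Proof.
have c0 : 0 < (1 - (beta N)^-1) / 2 by have := betaN_inv; lra.
apply: (@bounded_le _ _ _ (((1 - (beta N)^-1) / 2)^-1 * K)) => k.
by rewrite ler_pdivlMl // (VN_update k).1; have [_ _ _ h] := iterates_bounded k.
Qed.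

Let bV i : (i < N)%N -> bounded_mx (fun k => V k i).
Proof.
move=> iN; apply: (@bounded_le _ _ _ (Vmax i ^+ 2)) => k.
rewrite -(sqr_sqrtr (sqn_ge0 _)); apply: lerXn2r; rewrite ?nnegrE ?sqrtr_ge0 ?Vmax0 //.
exact: V_bounded.
Qed.

Let bshift m p (M : nat -> 'M[R]_(m, p)) : bounded_mx M -> bounded_mx (fun k => M k.+1).
Proof. by move=> [C C0 h]; exists C => // k; exact: h. Qed.

Notation mu_ s i := (mult X beta s i).

(** The multiplier step reads [beta i *: feas = L k.+2 i - L k.+1 i]. This bounds [mult] by the
    multipliers alone, with no bound on [U]. *)
Let multE k i : (1 <= i < N)%N -> mu_ (Xs k.+2) i = L k.+2 i + (L k.+2 i - L k.+1 i).
Proof. by move=> iN; rewrite /mult /feas {3}Lam_update // (addrC (L k.+1 i)) addrK. Qed.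

Let multNE k : multN N X beta (Xs k.+2) = LN k.+2 + (LN k.+2 - LN k.+1).
Proof. by rewrite /multN /feasN {3}LamN_update (addrC (LN k.+1)) addrK. Qed.

Let b_mult i : (1 <= i < N)%N -> bounded_mx (fun k => mu_ (Xs k.+2) i).
Proof.
move=> iN; have h1 := bL iN; have h2 := bshift h1.
have := mdominatedD h2 (mdominatedB h2 h1).
by apply: dominated_le => k; rewrite multE.
Qed.

Let b_multN : bounded_mx (fun k => multN N X beta (Xs k.+2)).
Proof.
have h1 := bLN; have h2 := bshift h1.
have := mdominatedD h2 (mdominatedB h2 h1).
by apply: dominated_le => k; rewrite multNE.
Qed.

Let eq_mdominated m p (A B : nat -> 'M[R]_(m, p)) :
  (forall k, A k = B k) -> mdominated E A -> mdominated E B.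
Proof. by move=> AB; apply: dominated_le => k; rewrite AB. Qed.

Let mdfeas i : (1 <= i < N)%N -> mdominated E (fun k => feas X (Xs k.+2) i).
Proof.
move=> iN; apply: eq_mdominated (mdominatedZ (beta i)^-1 (mdL iN)) => k.
by rewrite Lam_update // (addrC (L k.+1 i)) addrK scalerA mulVf ?gt_eqF ?betai0 // scale1r.
Qed.

Let mdfeasN : mdominated E (fun k => feasN N X (Xs k.+2)).
Proof.
apply: eq_mdominated (mdominatedZ (beta N)^-1 mdLN) => k.
by rewrite LamN_update (addrC (LN k.+1)) addrK scalerA mulVf ?gt_eqF // scale1r.
Qed.

(** Substituting the formula for [L k.+2 i] cancels the residual up to the lag of [V_i], which the
    [U] step sees at its old value. What remains is minus the sum of a [V] increment times [sigma'],
    a proximal term and a multiplier increment. *)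
Let mdgradU i : (1 <= i < N)%N ->
  mdominated E (fun k => gradU X mu beta sigma (Xs k.+2) i).
Proof.
move=> iN; have [U1 _] := mdU iN.
have iN' : (i < N)%N by case/andP: iN.
have [V1 _] := mdV iN'.
have h1 : mdominated E (fun k => hmul (V k.+2 i - V k.+1 i) (act (derive1 (sigma i)) (U k.+2 i))).
  apply: (mdominated_entrywise (c := psi1) _ V1) => k x y.
  by rewrite !mxE normrM mulrC ler_wpM2r //; exact: dsigma_bounded.
have h2 : mdominated E (fun k => omega i k.+1 *: (U k.+2 i - U k.+1 i)).
  apply: (mdominated_entrywise (c := beta i) _ U1) => k x y.
  rewrite mxE normrM ler_wpM2r // gtr0_norm ?omega0 //; exact: omega_le.
have := mdominatedD (mdominatedD (mdominatedZ mu h1) h2) (mdL iN).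
move=> /(mdominatedN); apply: eq_mdominated => k.
rewrite /gradU multE // {3}(U_update k.+1 iN).1 /resid.
by apply/matrixP => x y; rewrite !mxE; ring.
Qed.

Let mdgradW i : (1 <= i < N)%N ->
  mdominated E (fun k => gradW X lam beta (Xs k.+2) i).
Proof.
move=> iN; have [U1 _] := mdU iN.
have iN' := pred_lt iN; have [V1 _] := mdV iN'.
have h1 := mdominatedD (mdL iN) (mdominatedZ (beta i)
  (mdominatedB (mdominated_mull (bshift (bW iN)) V1) U1)).
have h2 := mdominated_mulr h1 (mdominated_tr (bshift (bV iN'))).
have h3 := mdominated_mull (b_mult iN) (mdominated_tr V1).
apply: eq_mdominated (mdominatedD h3 h2) => k.
exact: ridge_gradient_shift (W_update k.+1 iN).1.
Qed.

Let predN : (N.-1 < N)%N.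
Proof. by case: N N3. Qed.

Let mdgradWN : mdominated E (fun k => gradWN N X lam beta (Xs k.+2)).
Proof.
have [V1 _] := mdV predN.
have h1 := mdominatedD mdLN (mdominatedZ (beta N)
  (mdominatedB (mdominated_mull (bshift bWN) V1) mdVN)).
have h2 := mdominated_mulr h1 (mdominated_tr (bshift (bV predN))).
have h3 := mdominated_mull b_multN (mdominated_tr V1).
apply: eq_mdominated (mdominatedD h3 h2) => k.
exact: ridge_gradient_shift (WN_update k.+1).1.
Qed.

Let mdgradVN : mdominated E (fun k => gradVN N X Y beta (Xs k.+2)).
Proof.
apply: eq_mdominated (mdominatedN mdLN) => k.
by rewrite /gradVN multNE -(VN_update k.+1).1 [in RHS]opprD addrA subrr add0r.
Qed.

Let mdact i : (1 <= i < N)%N ->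
  mdominated E (fun k => act (sigma i) (U k.+2 i) - act (sigma i) (U k.+1 i)).
Proof.
move=> iN; have [U1 _] := mdU iN.
apply: (mdominated_entrywise (c := psi1) _ U1) => k x y.
by rewrite !mxE; exact: sigma_lipschitz.
Qed.

Let mdgradV_last : mdominated E (fun k => gradV N X mu beta sigma (Xs k.+2) N.-1).
Proof.
have h1 := mdominated_mull (mdominated_tr (bshift bWN))
  (mdominatedB mdLN (mdominatedZ (beta N) mdVN)).
apply: eq_mdominated h1 => k.
rewrite /gradV prednK ?eqxx; last exact: ltn_trans N3.
have := (V_last_update k.+1).1; rewrite /multN /feasN /resid => /eqP.
rewrite addr_eq0 => /eqP e.
have -> : mu *: (V k.+2 N.-2 + act (sigma N.-1) (U k.+2 N.-1) - V k.+2 N.-1)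
  = (WN k.+2)^T *m (LN k.+1 + beta N *: (WN k.+2 *m V k.+2 N.-1 - VN k.+1)).
  by apply: oppr_inj; rewrite -e -scalerN opprB.
rewrite -mulmxBr; congr (_ *m _); move: (WN k.+2 *m _) => w.
by apply/matrixP => x y; rewrite !mxE; ring.
Qed.

(** Subtracting the stationarity of the [V_i] step leaves only what changes after it in the sweep:
    [U], [V] and [Lam] of layer [i.+1]. *)
Let mdgradV i : (1 <= i < N)%N ->
  mdominated E (fun k => gradV N X mu beta sigma (Xs k.+2) i).
Proof.
move=> /andP[i1 iN]; have [e|ne] := eqVneq i.+1 N.
  have -> : i = N.-1 by rewrite -e.
  exact: mdgradV_last.
have iN1 : (1 <= i.+1 < N)%N by rewrite /= ltn_neqAle ne.
have [U1 _] := mdU iN1.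
have [V1 _] := mdV (i := i.+1) (proj2 (andP iN1)).
have h1 := mdominated_mull (mdominated_tr (bshift (bW iN1)))
  (mdominatedB (mdL iN1) (mdominatedZ (beta i.+1) U1)).
have h2 := mdominatedZ mu (mdominatedB (mdact iN1) V1).
apply: eq_mdominated (mdominatedD h2 h1) => k.
have := (V_update k.+1 i1 (proj2 (andP iN1))).1.
rewrite /gradV (negPf ne) /mult /feas /resid [i.+1.-1]/= => e.
set P := L k.+1 i.+1 + _ in e.
have -> : (W k.+2 i.+1)^T *m (L k.+2 i.+1 - L k.+1 i.+1
    - beta i.+1 *: (U k.+2 i.+1 - U k.+1 i.+1)) =
  (W k.+2 i.+1)^T *m (L k.+2 i.+1 + beta i.+1 *: (W k.+2 i.+1 *m V k.+2 i - U k.+2 i.+1))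
    - (W k.+2 i.+1)^T *m P.
  rewrite -mulmxBr; congr (_ *m _); rewrite /P; move: (W k.+2 i.+1 *m _) => w.
  by apply/matrixP => x y; rewrite !mxE; ring.
move/eqP: e; rewrite addrC addr_eq0 => /eqP ->.
move: (_ *m (L k.+2 i.+1 + _)) => Q.
by apply/matrixP => x y; rewrite !mxE; ring.
Qed.

Lemma grad_sqn_dominated :
  dominated E (fun k => grad_sqn N X Y lam mu beta sigma (Xs k.+2)).
Proof.
rewrite /grad_sqn; apply: dominatedD; last exact: mdfeasN.
apply: dominatedD; last exact: mdgradVN.
apply: dominatedD; last exact: mdgradWN.
apply: dominated_sum_nat => i iN; apply: dominatedD; last exact: mdfeas.
apply: dominatedD; last exact: mdgradV.
by apply: dominatedD; [exact: mdgradW | exact: mdgradU].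
Qed.

Lemma grad_sqn_summable : exists S, forall k,
  \sum_(1 <= l < k.+1) grad_sqn N X Y lam mu beta sigma (Xs l) <= S.
Proof.
have [C C0 hC] := grad_sqn_dominated.
pose g l := grad_sqn N X Y lam mu beta sigma (Xs l).
have hD k : \sum_(l < k) Drop l.+1 <= K.
  have := Phi_sum k; have := Phi_ge k; rewrite /K.
  have [hW hWN hU hVN] := iterates_bounded k.
  have s1 : 0 <= \sum_(1 <= i < N) (lam / 2 * sqn (W k.+1 i)).
    by apply: sumr_ge0 => i _; apply: mulr_ge0; [exact: ltW | exact: sqn_ge0].
  have s2 : 0 <= lam / 2 * sqn (WN k.+1) by apply: mulr_ge0; [exact: ltW | exact: sqn_ge0].
  have s3 : 0 <= \sum_(1 <= i < N) (3 * omega i k ^+ 2 / beta i * dU2 k i).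
    rewrite big_nat_cond; apply: sumr_ge0 => i; rewrite andbT => iN.
    have b0 := ltW (betai0 iN); apply: mulr_ge0; last exact: sqn_ge0.
    by apply: divr_ge0 => //; apply: mulr_ge0 => //; exact: sqr_ge0.
  have s4 : 0 <= (1 - (beta N)^-1) / 2 * sqn (VN k.+1 - Y).
    by apply: mulr_ge0; [apply: divr_ge0 => //; exact: ltW | exact: sqn_ge0].
  lra.
(* [Phi_sum] controls the drops from index 1 on, so [Drop 0] is carried as a constant. *)
have hE k : \sum_(l < k) E l <= Drop 0 + 2 * K.
  have e : \sum_(l < k) Drop l <= Drop 0 + \sum_(l < k) Drop l.+1.
    rewrite -(big_ord_recl k (fun l => Drop l)) big_ord_recr /= lerDl; exact: Drop_ge0.
  by rewrite /E big_split /=; have := hD k; lra.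
have g1 : 0 <= g 1%N.
  rewrite /g /grad_sqn !addr_ge0 ?sqn_ge0 //; apply: sumr_ge0 => i _.
  by rewrite !addr_ge0 ?sqn_ge0.
have B0 : 0 <= C * (Drop 0 + 2 * K).
  by apply: mulr_ge0 => //; have := hE 0%N; rewrite big_ord0.
(* Domination starts at [Xs 2]; the gradient at [Xs 1] is a separate constant. *)
exists (g 1%N + C * (Drop 0 + 2 * K)) => -[|k].
  by rewrite big_geq //; exact: addr_ge0.
rewrite big_ltn // -/(g 1%N) lerD2l 2!big_add1 /= big_mkord.
apply: (@le_trans _ _ (\sum_(l < k) C * E l)); first by apply: ler_sum => l _; exact: hC.
by rewrite -mulr_sumr ler_wpM2l.
Qed.

End ADMM.

Unset Implicit Arguments.

Theorem mainTheorem14 (R : realType) (d n q N : nat)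
  (X : 'M[R]_(d, n)) (Y : 'M[R]_(q, n)) (lam mu : R) (beta : nat -> R)
  (sigma : nat -> R -> R) (psi0 psi1 psi2 : R)
  (Vmax : nat -> R) (epsh eps : nat -> R) (omega : nat -> nat -> R)
  (Xs : nat -> state R d n q) :
  (3 <= N)%N -> 0 < lam -> 0 < mu ->
  (forall i, (1 <= i <= N)%N -> 0 < beta i) ->
  0 < psi0 -> 0 < psi1 -> 0 < psi2 ->
  (forall i, (1 <= i < N)%N ->
     real_analytic (sigma i) /\
     forall x : R, `|sigma i x| <= psi0 /\ `|derive1 (sigma i) x| <= psi1
                   /\ `|derive1n 2 (sigma i) x| <= psi2) ->
  frob X < Vmax 0%N ->
  (forall i, (1 <= i < N)%N -> 0 < Vmax i) ->
  let a i := psi0 * psi2 + psi1 ^+ 2 + Vmax i * psi2 + Vmax i.-1 * psi2 in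
  (* (A1) *)
  (forall i, (1 <= i < N)%N ->
     Num.max (32 * (1 + Num.sqrt 2) * mu * a i) (16 * mu * psi1 ^+ 2) < beta i) ->
  1 < beta N ->
  (* (A2) *)
  let Delta i := (beta i / 4 - 8 * mu * a i) ^+ 2 - 128 * mu ^+ 2 * a i ^+ 2 in
  let omin i := (beta i / 4 - 8 * mu * a i - Num.sqrt (Delta i)) / 16 + epsh i in
  let omax i := Num.min
      ((beta i / 4 - 8 * mu * a i + Num.sqrt (Delta i)) / 16 - epsh i)
      (Num.sqrt (omin i ^+ 2 + beta i * omin i / 16 - beta i * eps i / 4)) in
  (forall i, (1 <= i < N)%N ->
     0 < epsh i < Num.sqrt (Delta i) / 32 /\ 0 < eps i < omin i / 4 /\
     forall k, omin i < omega i k /\ omega i k <= omega i k.+1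
               /\ omega i k.+1 < omax i) ->
  (* the iterates *)
  @is_3s_ppADMM R d n q N X Y lam mu beta sigma omega Xs ->
  (* (A3) *)
  (forall i k, (1 <= i < N)%N -> frob (sV (Xs k) i) <= Vmax i) ->
  exists c : R, 0 < c /\ forall k : nat, (1 <= k)%N ->
    let g l := @grad_norm R d n q N X Y lam mu beta sigma (Xs l) in
    (k%:R)^-1 * (\sum_(1 <= l < k.+1) g l) <= c / Num.sqrt k%:R
    /\ \big[Num.min/g 1%N]_(1 <= l < k.+1) g l <= c / Num.sqrt k%:R.
Proof.
move=> N3 lam0 mu0 beta0 psi00 psi10 psi20 sigmaP XV Vmax0 a betaP betaN Delta omin omax.
move=> omegaP admm VP.
have sder i : (1 <= i < N)%N -> forall x, derivable (sigma i) x 1.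
  by move=> /sigmaP[sa _] x; exact: real_analytic_derivable.
have sb i : (1 <= i < N)%N -> forall x, `|sigma i x| <= psi0.
  by move=> /sigmaP[_ h] x; have [] := h x.
have db i : (1 <= i < N)%N -> forall x, `|derive1 (sigma i) x| <= psi1.
  by move=> /sigmaP[_ h] x; have [_ []] := h x.
have sl i : (1 <= i < N)%N -> forall x y,
    `|sigma i x - sigma i y| <= psi1 * `|x - y|.
  by move=> iN; apply: bounded_derive1_lipschitz; [exact: sder | exact: db].
have dl i : (1 <= i < N)%N -> forall x y,
    `|derive1 (sigma i) x - derive1 (sigma i) y| <= psi2 * `|x - y|.
  move=> /sigmaP[sa h]; apply: bounded_derive1_lipschitz => x.
    by apply: real_analytic_derivable; exact: real_analytic_derive1.
  by have [_ [_]] := h x.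
have Vb i k : (i < N)%N -> frob (Vx X (sV (Xs k)) i) <= Vmax i.
  by case: i => [_|i iN]; [exact: ltW | exact: VP].
have bl i : (1 <= i < N)%N -> 16 * mu * psi1 ^+ 2 < beta i.
  by move=> /betaP; rewrite gt_max => /andP[].
have om0 i : (1 <= i < N)%N -> 0 < omin i.
  by move=> /omegaP[_ [/andP[e0 e1] _]]; have := lt_trans e0 e1; lra.
have omge i k : (1 <= i < N)%N -> omin i <= omega i k.
  by move=> iN; have [_ [_ h]] := omegaP i iN; have [/ltW] := h k.
(* the two bounds on [omega] place it between the roots of this quadratic *)
have omq i k : (1 <= i < N)%N -> 8 * omega i k ^+ 2 + 8 * mu * a i * omega i k
    + 4 * mu ^+ 2 * a i ^+ 2 <= beta i * omega i k / 4.
  move=> iN; have [/andP[e0 e1] [_ ho]] := omegaP i iN; have [w1 [w2 w3]] := ho k.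
  move: w3; rewrite /omax lt_min => /andP[w3 _].
  (* [Num.sqrt] is zero on negative arguments, so its positivity, forced by the range of [epsh i],
     also gives [Delta i > 0]. *)
  have D0 : 0 < Num.sqrt (Delta i) by have := lt_trans e0 e1; lra.
  have De : Num.sqrt (Delta i) ^+ 2 = Delta i.
    by apply: sqr_sqrtr; apply: ltW; rewrite -sqrtr_gt0.
  move: w1 w3 D0 De; rewrite /omin /Delta; move: (Num.sqrt _) => s w1 w3 D0 De.
  have p1 : 0 <= 16 * omega i k - (beta i / 4 - 8 * mu * a i) + s by lra.
  have p2 : 0 <= (beta i / 4 - 8 * mu * a i) + s - 16 * omega i k by lra.
  (* With [B = beta i / 4 - 8 mu a_i], the product is [s^2 - (16 omega - B)^2], which is 32 times
     the difference of the two sides. *)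
  by have := mulr_ge0 p1 p2; nra.
have [S hS] := @grad_sqn_summable R d n q N X Y lam mu beta sigma psi0 psi1 psi2 Vmax a
  omin omega Xs N3 lam0 mu0 beta0 psi00 psi10 psi20 sder sb db sl dl Vb
  (fun=> erefl) bl betaN om0 omge omq admm.
pose g l := grad_norm N X Y lam mu beta sigma (Xs l).
have g0 l : 0 <= g l by exact: sqrtr_ge0.
have gS k : \sum_(1 <= l < k.+1) g l ^+ 2 <= S.
  apply: le_trans (hS k); apply: ler_sum => l _.
  rewrite /g grad_normE // sqr_sqrtr // /grad_sqn !addr_ge0 ?sqn_ge0 //.
  by apply: sumr_ge0 => i _; rewrite !addr_ge0 ?sqn_ge0.
exists (Num.sqrt (S + 1)); split=> [|k k1].
  by have := gS 0%N; rewrite big_geq // sqrtr_gt0; lra.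
have avg := average_le g0 gS k1.
by split=> //; apply: le_trans avg; exact: bigmin_le_average.
Qed.
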